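(* Let $\mathfrak{X}$ be a transitive saturated fusion action system of a finite $p$-group $S$ on a finite set $X$, with underlying fusion system $\mathcal{F}$, and let $\mathcal{L}^{\mathfrak{X}}$ be a linking action system associated to $\mathfrak{X}$. If $x\in X$ is fully stabilized, then the stabilizer fusion system $\mathcal{F}_x\subseteq\mathcal{F}$ on $S_x$ is saturated, and the stabilizer linking action system $\mathcal{L}^{\mathfrak{X}}_x$ (with the restricted structure functors) is a transporter system associated to $\mathcal{F}_x$.
   Context: Let $p$ be a prime, $S$ a finite $p$-group, and $X$ a finite set with a left $S$-action; $\Sigma_X$ is the symmetric group on $X$, $\ell_s\in\Sigma_X$ is the permutation $x\mapsto s\cdot x$, and $c_s$ is conjugation $h\mapsto shs^{-1}$. $\mathrm{Inj}(P,Q)$ is the set of injective homomorphisms $P\to Q$. A pair $(\varphi,\sigma)\in\mathrm{Inj}(P,Q)\times\Sigma_X$ ($P,Q\le S$) is intertwined if $\sigma\ell_p\sigma^{-1}=\ell_{\varphi(p)}$ for all $p\in P$. Let $\mathfrak{U}$ be the category whose objects are all subgroups of $S$, whose morphisms $P\to Q$ are the intertwined pairs, composed componentwise. Let $\mathfrak{X}_S\subseteq\mathfrak{U}$ have the same objects and morphisms $P\to Q$ the pairs $(c_s|_P,\ell_s)$ with $s\in S$, $sPs^{-1}\le Q$. A fusion action system of $S$ on $X$ is a category $\mathfrak{X}$ with $\mathfrak{X}_S\subseteq\mathfrak{X}\subseteq\mathfrak{U}$ such that every morphism of $\mathfrak{X}$ factors as an isomorphism of $\mathfrak{X}$ followed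 by an inclusion $(\mathrm{incl},\mathrm{id}_X)$. Write $\mathfrak{X}(P)=\mathfrak{X}(P,P)$ and $\mathfrak{X}(P,Q)_{\mathrm{iso}}$ for the isomorphisms; $\mathfrak{X}(1)$ is identified with a subgroup of $\Sigma_X$. The underlying fusion system $\mathcal{F}^{\mathfrak{X}}$ has the subgroups of $S$ as objects and $\mathcal{F}^{\mathfrak{X}}(P,Q)=\{\varphi : \exists\sigma,\ (\varphi,\sigma)\in\mathfrak{X}(P,Q)\}$; two subgroups are conjugate if they are isomorphic in $\mathcal{F}^{\mathfrak{X}}$. Let $C=\{s\in S:\ell_s=\mathrm{id}_X\}$, $N_S(P;X)=N_S(P)\cap C$, $Z_S(P;X)=Z_S(P)\cap C$. A subgroup $P\le S$ is fully normalized (resp. fully centralized, fully $X$-normalized, fully $X$-centralized) if $|N_S(P)|\ge|N_S(Q)|$ (resp. the same inequality for $Z_S(-)$, $N_S(-;X)$, $Z_S(-;X)$) for all $Q$ conjugate to $P$. Put $\mathrm{Aut}_S(P)=\{c_s|_P:s\in N_S(P)\}$, $\mathrm{Aut}_S(P;X)=\{(c_s|_P,\ell_s):s\in N_S(P)\}$, $\Sigma_{\mathfrak{X}}(P)=\{\sigma:\exists\varphi,(\varphi,\sigma)\in\mathfrak{X}(P)\}$, $\Sigma^S_{\mathfrak{X}}(P)=\{\ell_s:s\in N_S(P)\}$, $\mathcal{F}^{\mathfrak{X}}(P)_0=\{\varphi:(\varphi,\mathrm{id}_X)\in\mathfrak{X}(P)\}$, $\mathcal{F}_S(P)_0=\{c_s|_P:s\in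 N_S(P;X)\}$, $\Sigma_{\mathfrak{X}}(P)_0=\{\sigma:(\mathrm{id}_P,\sigma)\in\mathfrak{X}(P)\}$, $\Sigma^S_{\mathfrak{X}}(P)_0=\{\ell_s:s\in Z_S(P)\}$. The extender of $(\varphi,\sigma)\in\mathfrak{X}(P,Q)_{\mathrm{iso}}$ is $N_{(\varphi,\sigma)}=\{n\in N_S(P):(\varphi c_n\varphi^{-1},\sigma\ell_n\sigma^{-1})\in\mathrm{Aut}_S(Q;X)\}$. $\mathfrak{X}$ is saturated if: (1) for every $P\le S$, fully normalized implies fully $X$-normalized and fully centralized, and each of fully $X$-normalized and fully centralized implies fully $X$-centralized; (2) if $P$ is fully normalized then $\mathrm{Aut}_S(P)\in\mathrm{Syl}_p(\mathcal{F}^{\mathfrak{X}}(P))$, $\mathrm{Aut}_S(P;X)\in\mathrm{Syl}_p(\mathfrak{X}(P))$ and $\Sigma^S_{\mathfrak{X}}(P)\in\mathrm{Syl}_p(\Sigma_{\mathfrak{X}}(P))$; (3) if $P$ is fully $X$-normalized then $\mathcal{F}_S(P)_0\in\mathrm{Syl}_p(\mathcal{F}^{\mathfrak{X}}(P)_0)$; (4) if $P$ is fully centralized then $\Sigma^S_{\mathfrak{X}}(P)_0\in\mathrm{Syl}_p(\Sigma_{\mathfrak{X}}(P)_0)$; (5) if $Q$ is fully $X$-centralized and $(\varphi,\sigma)\in\mathfrak{X}(P,Q)_{\mathrm{iso}}$, there is $(\widetilde\varphi,\sigma)\in\mathfrak{X}(N_{(\varphi,\sigma)},S)$ with $\widetilde\varphi|_P=\varphi$.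 $\mathfrak{X}$ is transitive if $\mathfrak{X}(1)$ acts transitively on $X$. $S_x$ is the stabilizer of $x$ in $S$; $x\in X$ is fully stabilized if $|S_x|\ge|S_y|$ for all $y\in X$. $\mathcal{F}_x$ is the fusion system on $S_x$ with $\mathcal{F}_x(P,Q)=\{\varphi:\exists\sigma\text{ with }(\varphi,\sigma)\in\mathfrak{X}(P,Q),\ \sigma(x)=x\}$ for $P,Q\le S_x$. $P\le S$ is $X$-centric if $Z(Q)\cap C=Z_S(Q;X)$ for all $Q$ conjugate to $P$; put $Z(P;X)=Z(P)\cap C$. For a $p$-group $T$ and a set $\mathcal{H}$ of subgroups, $\mathcal{T}_T^{\mathcal{H}}(T)$ is the category with object set $\mathcal{H}$ and morphisms $N_T(P,Q)=\{t\in T:tPt^{-1}\le Q\}$, composed by multiplication; $\mathcal{T}_S^{cX}$ is the case $T=S$, $\mathcal{H}$ the $X$-centric subgroups. $\mathfrak{X}^{cX}$ is the full subcategory of $\mathfrak{X}$ on the $X$-centric subgroups. An ($X$-centric) linking action system associated to $\mathfrak{X}$ is a category $\mathcal{L}^{\mathfrak{X}}$ whose objects are the $X$-centric subgroups of $S$, with functors $\mathcal{T}_S^{cX}\xrightarrow{\delta}\mathcal{L}^{\mathfrak{X}}\xrightarrow{\pi}\mathfrak{X}^{cX}$; write $\widehat s=\delta_{P,Q}(s)$ and $\pi(\mathfrak{g})=(c_{\mathfrak{g}},\ell_{\mathfrak{g}})$. It satisfies: (A) $\delta,\pi$ are the identity on objects, $\delta$ is injective and $\pi$ surjective on morphisms,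 $Z(P;X)$ acts (via $\delta$) freely on the right on $\mathcal{L}^{\mathfrak{X}}(P,Q)$, and $\pi_{P,Q}$ is the orbit map of this action; (B) for $p\in P$, $c_{\widehat p}=c_p$ and $\ell_{\widehat p}=\ell_p$; (C) for $\mathfrak{g}\in\mathcal{L}^{\mathfrak{X}}(P,Q)$ and $p\in P$, $\widehat{c_{\mathfrak{g}}(p)}\circ\mathfrak{g}=\mathfrak{g}\circ\widehat p$. $\mathcal{L}^{\mathfrak{X}}_x$ is the subcategory whose objects are the $X$-centric subgroups contained in $S_x$ with $\mathcal{L}^{\mathfrak{X}}_x(P,Q)=\{\mathfrak{g}\in\mathcal{L}^{\mathfrak{X}}(P,Q):\ell_{\mathfrak{g}}(x)=x\}$; its structure functors are the restriction of $\delta$ to $\mathcal{T}_{S_x}^{\mathrm{Ob}}(S_x)$ and the functor $\mathfrak{g}\mapsto c_{\mathfrak{g}}$ to $\mathcal{F}_x$. A fusion system $\mathcal{E}$ on a finite $p$-group $T$ is a category whose objects are all subgroups of $T$, with $\mathcal{E}(P,Q)\subseteq\mathrm{Inj}(P,Q)$ containing all $c_t|_P$ for $t\in T$, $tPt^{-1}\le Q$, every morphism factoring as an isomorphism of $\mathcal{E}$ followed by an inclusion. $P\le T$ is fully normalized (centralized) in $\mathcal{E}$ if $|N_T(P)|$ (resp. $|Z_T(P)|$) is maximal over the subgroups isomorphic to $P$ in $\mathcal{E}$. $\mathcal{E}$ is saturated if every fully normalized $P$ is fully centralized with $\mathrm{Aut}_T(P)\in\mathrm{Syl}_p(\mathcal{E}(P))$,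 and for every fully centralized $Q$ and isomorphism $\varphi\in\mathcal{E}(P,Q)$ there is $\widetilde\varphi\in\mathcal{E}(N_\varphi,T)$ extending $\varphi$, where $N_\varphi=\{n\in N_T(P):\varphi c_n\varphi^{-1}\in\mathrm{Aut}_T(Q)\}$. A transporter system associated to a fusion system $\mathcal{E}$ on $T$ is a category $\mathcal{T}$ whose objects are a set of subgroups of $T$ closed under $\mathcal{E}$-conjugacy and overgroups, with functors $\mathcal{T}_T^{\mathrm{Ob}(\mathcal{T})}(T)\xrightarrow{\delta}\mathcal{T}\xrightarrow{\pi}\mathcal{E}$ (write $\widehat t=\delta_{P,Q}(t)$, $c_{\mathfrak{g}}=\pi_{P,Q}(\mathfrak{g})$) such that: (A1) on objects $\delta$ is the identity and $\pi$ the inclusion; (A2) with $E(P)=\ker[\mathcal{T}(P)\to\mathcal{E}(P)]$, $E(P)$ acts right-freely and $E(Q)$ left-freely on $\mathcal{T}(P,Q)$, and $\pi_{P,Q}:\mathcal{T}(P,Q)\to\mathcal{E}(P,Q)$ is the orbit map of the $E(P)$-action; (B) $\delta$ is injective on morphisms and $c_{\widehat t}=c_t$; (C) $\widehat{c_{\mathfrak{g}}(p)}\circ\mathfrak{g}=\mathfrak{g}\circ\widehat p$ for $\mathfrak{g}\in\mathcal{T}(P,Q)$, $p\in P$; (I) $\delta_{T,T}(T)\in\mathrm{Syl}_p(\mathcal{T}(T))$; (II) for every isomorphism $\mathfrak{g}\in\mathcal{T}(P,Q)$ and $P\trianglelefteq\widetilde P\le T$, $Q\trianglelefteq\widetilde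 Q\le T$ with $\mathfrak{g}\,\delta_{P,P}(\widetilde P)\,\mathfrak{g}^{-1}\le\delta_{Q,Q}(\widetilde Q)$, there is $\widetilde{\mathfrak{g}}\in\mathcal{T}(\widetilde P,\widetilde Q)$ with $\widetilde{\mathfrak{g}}\circ\delta_{P,\widetilde P}(1)=\delta_{Q,\widetilde Q}(1)\circ\mathfrak{g}$. *)

(* Defs.v *)
From HB Require Import structures.
From mathcomp Require Import all_boot all_fingroup all_solvable.

Set Implicit Arguments.
Unset Strict Implicit.
Unset Printing Implicit Defensive.

Import GroupScope.
Local Open Scope group_scope.

Section Categories.

(* Hom-sets are finite types: every category below has finite hom-sets (in a
   linking action system they are finite unions of orbits of finite groups). *)
Record category (O : Type) := Category {
  hom : O -> O -> finType;
  cid : forall P, hom P P;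
  ccomp : forall P Q R, hom Q R -> hom P Q -> hom P R;
  ccomp1m : forall P Q (f : hom P Q), ccomp (cid Q) f = f;
  ccompm1 : forall P Q (f : hom P Q), ccomp f (cid P) = f;
  ccompA : forall P Q R W (f : hom P Q) (g : hom Q R) (h : hom R W),
    ccomp h (ccomp g f) = ccomp (ccomp h g) f
}.

Definition inverse_pair O (C : category O) (P Q : O)
    (f : hom C P Q) (g : hom C Q P) : bool :=
  (ccomp g f == cid C P) && (ccomp f g == cid C Q).

(* All functors used here are the identity on objects once the object sets
   are identified, so only the action on morphisms is recorded. *)
Record functor O (C D : category O) := Functor {
  fmap :> forall P Q, hom C P Q -> hom D P Q;
  fmap1 : forall P, fmap (cid C P) = cid D P;
  fmapM : forall P Q R (f : hom C P Q) (g : hom C Q R),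
    fmap (ccomp g f) = ccomp (fmap g) (fmap f)
}.

Definition autg O (C : category O) (P : O) : Type :=
  {f : hom C P P | [exists g, inverse_pair f g]}.

End Categories.

Section AutGroup.

Variables (O : Type) (C : category O) (P : O).

HB.instance Definition _ := Finite.on (autg C P).

Fact aut1_subproof : [exists g, inverse_pair (cid C P) g].
Proof. by apply/existsP; exists (cid C P); rewrite /inverse_pair ccomp1m eqxx. Qed.

Fact autM_subproof (a b : autg C P) :
  [exists g, inverse_pair (ccomp (val a) (val b)) g].
Proof.
have /existsP[a' /andP[/eqP a'a /eqP aa']] := valP a.
have /existsP[b' /andP[/eqP b'b /eqP bb']] := valP b.
apply/existsP; exists (ccomp b' a'); rewrite /inverse_pair.
rewrite -!ccompA (ccompA _ (val a)) a'a ccomp1m b'b eqxx /=.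
by rewrite (ccompA _ b') bb' ccomp1m aa' eqxx.
Qed.

Definition aut1 : autg C P := exist _ (cid C P) aut1_subproof.
Definition autM (a b : autg C P) : autg C P := exist _ (ccomp (val a) (val b)) (autM_subproof a b).
Definition autV (a : autg C P) : autg C P :=
  odflt aut1 [pick b : autg C P | autM b a == aut1].

Fact autMA : associative autM.
Proof. by move=> a b c; apply: val_inj; rewrite /= ccompA. Qed.

Fact aut1M : left_id aut1 autM.
Proof. by move=> a; apply: val_inj; rewrite /= ccomp1m. Qed.

Fact autVM : left_inverse aut1 autV autM.
Proof.
move=> a; rewrite /autV; case: pickP => [b /eqP //|].
have /existsP[b /andP[/eqP ba /eqP ab]] := valP a.
have bP : [exists g, inverse_pair b g].
  by apply/existsP; exists (val a); rewrite /inverse_pair ab ba !eqxx.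
by move/(_ (exist _ b bP))/eqP; case; apply: val_inj.
Qed.

HB.instance Definition _ := Finite_isGroup.Build (autg C P) autMA aut1M autVM.

End AutGroup.

Section FusionSystems.

Variable gT : finGroupType.
Implicit Types P Q R T : {group gT}.

(* A homomorphism P -> Q is encoded by its extension to gT with value 1
   outside P; composites of such extensions are again of this form, and
   pid P encodes the identity of P as well as every inclusion P -> Q. *)
Definition restr (P : {set gT}) (f : gT -> gT) : {ffun gT -> gT} :=
  [ffun x => if x \in P then f x else 1].

Definition Inj P Q : {set {ffun gT -> gT}} :=
  [set f : {ffun gT -> gT} | [&& morphic P f, dinjectiveb f P,
                                 f @: P \subset Q & f == restr P f]].

Definition pid (P : {set gT}) := restr P id.
Definition hcomp (g f : {ffun gT -> gT}) : {ffun gT -> gT} := [ffun x => g (f x)].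
Definition pinv (P : {set gT}) (f : {ffun gT -> gT}) : {ffun gT -> gT} :=
  [ffun y => odflt 1 [pick x in P | f x == y]].
Definition lconj (P : {set gT}) (s : gT) := restr P (fun h => s * h * s^-1).

(* In MathComp P :^ s^-1 is s P s^-1. *)
Definition transp (T P Q : {set gT}) : {set gT} :=
  [set t in T | P :^ t^-1 \subset Q].

Definition isos_of (E : {group gT} -> {group gT} -> {set {ffun gT -> gT}}) P Q :=
  [set f in E P Q | [exists g in E Q P,
                       (hcomp g f == pid P) && (hcomp f g == pid Q)]].

(* Only the sets E P Q with P, Q \subset T are meaningful.  Identities belong
   to E because c_1 does. *)
Record fusion_system (T : {group gT}) := FusionSystem {
  fsys :> {group gT} -> {group gT} -> {set {ffun gT -> gT}};
  fs_inj : forall P Q, P \subset T -> Q \subset T -> fsys P Q \subset Inj P Q;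
  fs_conj : forall P Q t, P \subset T -> Q \subset T ->
    t \in transp T P Q -> lconj P t \in fsys P Q;
  fs_comp : forall P Q R f g, P \subset T -> Q \subset T -> R \subset T ->
    f \in fsys P Q -> g \in fsys Q R -> hcomp g f \in fsys P R;
  fs_fact : forall P Q f, P \subset T -> Q \subset T -> f \in fsys P Q ->
    exists R : {group gT}, R \subset Q /\
      exists2 g, g \in isos_of fsys P R & f = hcomp (pid R) g
}.

Section Saturation.

Variables (p : nat) (T : {group gT}) (E : fusion_system T).

Definition fconjugate P Q : bool := isos_of E P Q != set0.

(* m P is the order of one of the normalizer-like subgroups attached to P. *)
Definition fully (m : {group gT} -> nat) P : Prop :=
  forall Q, Q \subset T -> fconjugate P Q -> m Q <= m P.

Definition fully_normalized := fully (fun P => #|'N_T(P)|).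
Definition fully_centralized := fully (fun P => #|'C_T(P)|).

Definition AutIn P : {set {ffun gT -> gT}} := [set lconj P s | s in 'N_T(P)].

(* A set of automorphisms of P, viewed in the MathComp group Aut P of
   permutations of gT fixing the complement of P pointwise. *)
Definition as_aut P (A : {set {ffun gT -> gT}}) : {set {perm gT}} :=
  [set a in Aut P | restr P a \in A].

Definition extender P Q (f : {ffun gT -> gT}) : {set gT} :=
  [set n in 'N_T(P) | hcomp f (hcomp (lconj P n) (pinv P f)) \in AutIn Q].

(* extender P Q f is a subgroup, so << >> only packages it as a {group gT}. *)
Record saturated : Prop := Saturated {
  sat_cent : forall P, P \subset T -> fully_normalized P -> fully_centralized P;
  sat_sylow : forall P, P \subset T -> fully_normalized P ->
    p.-Sylow(as_aut P (E P P)) (as_aut P (AutIn P));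
  sat_ext : forall P Q f, P \subset T -> Q \subset T -> fully_centralized Q ->
    f \in isos_of E P Q ->
    exists2 f', f' \in E <<extender P Q f>>%G T & restr P f' = f
}.

End Saturation.

Section Objects.

(* The subgroups of T lying in H. *)
Definition ob (T : {group gT}) (H : {set {group gT}}) : Type :=
  {P : {group gT} | (P \in H) && (P \subset T)}.

Definition obg T H (P : ob T H) : {group gT} := val P.

Variables (T : {group gT}) (H : {set {group gT}}).

Lemma ob_mem (P : ob T H) : obg P \in H.
Proof. by case/andP: (valP P). Qed.

Lemma ob_sub (P : ob T H) : obg P \subset T.
Proof. by case/andP: (valP P). Qed.

Definition transporter_hom (P Q : ob T H) : finType :=
  {t : gT | t \in transp T (obg P) (obg Q)}.

Fact transporter1_subproof (P : ob T H) : 1 \in transp T (obg P) (obg P).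
Proof. by rewrite inE group1 invg1 conjsg1 /=. Qed.

Fact transporterM_subproof (P Q R : ob T H)
    (t : transporter_hom Q R) (s : transporter_hom P Q) :
  val t * val s \in transp T (obg P) (obg R).
Proof.
case: t s => [t /= ht] [s /= hs]; move: ht hs; rewrite !inE.
case/andP=> tT htQ /andP[sT hsP]; rewrite groupM //= invMg conjsgM.
by apply: subset_trans htQ; rewrite conjSg.
Qed.

Definition transporter1 (P : ob T H) : transporter_hom P P :=
  exist _ 1 (transporter1_subproof P).
Definition transporterM (P Q R : ob T H)
    (t : transporter_hom Q R) (s : transporter_hom P Q) : transporter_hom P R :=
  exist _ (val t * val s) (transporterM_subproof t s).

Definition transporter_category : category (ob T H).
Proof.
refine (@Category _ transporter_hom transporter1 transporterM _ _ _).
- by move=> P Q s; apply: val_inj; rewrite /= mul1g.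
- by move=> P Q s; apply: val_inj; rewrite /= mulg1.
- by move=> P Q R W s t u; apply: val_inj; rewrite /= mulgA.
Defined.

Variable E : fusion_system T.

Definition fusion_hom (P Q : ob T H) : finType :=
  {f : {ffun gT -> gT} | f \in E (obg P) (obg Q)}.

Fact pid_fsys P : P \subset T -> pid P \in E P P.
Proof.
move=> PT; have -> : pid P = lconj P 1.
  by apply/ffunP=> x; rewrite !ffunE invg1 mulg1 mul1g.
by apply: fs_conj => //; rewrite inE group1 invg1 conjsg1 /=.
Qed.

Definition fusion1 (P : ob T H) : fusion_hom P P := exist _ (pid (obg P)) (pid_fsys (ob_sub P)).
Definition fusionM (P Q R : ob T H) (g : fusion_hom Q R) (f : fusion_hom P Q) :
    fusion_hom P R :=
  exist _ (hcomp (val g) (val f))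
    (fs_comp (ob_sub P) (ob_sub Q) (ob_sub R) (valP f) (valP g)).

Lemma Inj_out P Q f x : f \in Inj P Q -> x \notin P -> f x = 1.
Proof.
by rewrite inE => /and4P[_ _ _ /eqP->] /negbTE xP; rewrite ffunE xP.
Qed.

Lemma Inj_in P Q f x : f \in Inj P Q -> f x \in Q.
Proof.
move=> fI; have [xP|/(Inj_out fI)->] := boolP (x \in P); last exact: group1.
by move: fI; rewrite inE => /and4P[_ _ /subsetP fQ _]; apply/fQ/imset_f.
Qed.

Lemma Inj1 P Q f : f \in Inj P Q -> f 1 = 1.
Proof.
rewrite inE => /and4P[/morphicP fM _ _ _]; apply: (mulgI (f 1)).
by rewrite -fM ?group1 // !mulg1.
Qed.

Lemma hcomp1f P Q f : f \in Inj P Q -> hcomp (pid Q) f = f.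
Proof. by move=> fI; apply/ffunP=> x; rewrite !ffunE (Inj_in _ fI). Qed.

Lemma hcompf1 P Q f : f \in Inj P Q -> hcomp f (pid P) = f.
Proof.
move=> fI; apply/ffunP=> x; rewrite !ffunE; case: ifPn => // xP.
by rewrite (Inj1 fI) (Inj_out fI).
Qed.

Lemma hcompA f g h : hcomp h (hcomp g f) = hcomp (hcomp h g) f.
Proof. by apply/ffunP=> x; rewrite !ffunE. Qed.

(* The full subcategory of E on the subgroups of T lying in H. *)
Definition fusion_category : category (ob T H).
Proof.
refine (@Category _ fusion_hom fusion1 fusionM _ _ _).
- move=> P Q f; apply: val_inj; apply: (@hcomp1f (obg P) (obg Q)).
  by apply: (subsetP (fs_inj E (ob_sub P) (ob_sub Q))); apply: valP.
- move=> P Q f; apply: val_inj; apply: (@hcompf1 (obg P) (obg Q)).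
  by apply: (subsetP (fs_inj E (ob_sub P) (ob_sub Q))); apply: valP.
- by move=> P Q R W f g h; apply: val_inj; rewrite /= hcompA.
Defined.

End Objects.

Arguments obg {T H}.

Section TransporterSystems.

Variables (p : nat) (T : {group gT}) (E : fusion_system T).
Variables (H : {set {group gT}}) (C : category (ob T H)).
Variables (delta : functor (transporter_category T H) C).
Variables (pi : functor C (fusion_category H E)).

Definition ker_pi (P : ob T H) : {set hom C P P} :=
  [set e | val (pi _ _ e) == pid (obg P)].

(* delta_{P,P}(R), for R normalizing P. *)
Definition delta_im (P : ob T H) (R : {set gT}) : {set hom C P P} :=
  [set delta P P t | t : hom (transporter_category T H) P P & val t \in R].

(* The object set is ob T H, i.e. the members of H contained in T.  The Sylow
   condition presupposes that T is an object, which for an object set closed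
   under overgroups says that there is at least one object.  The group of
   automorphisms of T in C is the whole of C(T), since ts_orbit and ts_freer
   make every endomorphism invertible. *)
Record transporter_system : Prop := TransporterSystem {
  ts_conj : forall (P : ob T H) (Q : {group gT}),
    Q \subset T -> fconjugate E (obg P) Q -> Q \in H;
  ts_over : forall (P : ob T H) (Q : {group gT}),
    Q \subset T -> obg P \subset Q -> Q \in H;
  ts_freer : forall (P Q : ob T H) (g : hom C P Q) (e : hom C P P),
    e \in ker_pi P -> ccomp g e = g -> e = cid C P;
  ts_freel : forall (P Q : ob T H) (g : hom C P Q) (e : hom C Q Q),
    e \in ker_pi Q -> ccomp e g = g -> e = cid C Q;
  ts_surj : forall (P Q : ob T H) (f : hom (fusion_category H E) P Q),
    exists g : hom C P Q, pi _ _ g = f;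
  ts_orbit : forall (P Q : ob T H) (g h : hom C P Q),
    pi _ _ g = pi _ _ h <-> exists2 e, e \in ker_pi P & h = ccomp g e;
  ts_inj : forall (P Q : ob T H), injective (delta P Q);
  ts_B : forall (P Q : ob T H) (t : hom (transporter_category T H) P Q),
    val (pi _ _ (delta _ _ t)) = lconj (obg P) (val t);
  ts_C : forall (P Q : ob T H) (g : hom C P Q)
      (u : hom (transporter_category T H) P P)
      (v : hom (transporter_category T H) Q Q),
    val u \in obg P -> val v = val (pi _ _ g) (val u) ->
    ccomp (delta _ _ v) g = ccomp g (delta _ _ u);
  ts_I : exists2 oT : ob T H, obg oT = T &
    p.-Sylow([set: autg C oT]) [set a | val a \in delta_im oT T];
  ts_II : forall (P Q P' Q' : ob T H) (g : hom C P Q) (h : hom C Q P),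
    inverse_pair g h -> obg P <| obg P' -> obg Q <| obg Q' ->
    (forall d, d \in delta_im P (obg P') ->
       ccomp g (ccomp d h) \in delta_im Q (obg Q')) ->
    exists g' : hom C P' Q',
      forall (i : hom (transporter_category T H) P P')
             (j : hom (transporter_category T H) Q Q'),
        val i = 1 -> val j = 1 ->
        ccomp g' (delta _ _ i) = ccomp (delta _ _ j) g
}.

End TransporterSystems.

End FusionSystems.

Arguments obg {gT T H}.

Section ActionSystems.

(* The finite p-group S is the whole finite group gT: its subgroups are the
   P : {group gT}, and N_S(P) = 'N(P), Z_S(P) = 'C(P). *)
Variables (gT : finGroupType) (X : finType).
Implicit Types P Q R : {group gT}.

(* MathComp actions are right actions. *)
Record left_action := LeftAction {
  lact :> gT -> X -> X;
  lact1 : forall x, lact 1 x = x;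
  lactM : forall s t x, lact (s * t) x = lact s (lact t x)
}.

Variable act : left_action.

Fact lact_inj s : injective (act s).
Proof.
apply: (can_inj (g := act s^-1)) => x.
by rewrite -lactM mulVg lact1.
Qed.

Definition ell (s : gT) : {perm X} := perm (@lact_inj s).

Definition core : {set gT} := [set s | ell s == 1].

Definition stab (x : X) : {set gT} := [set s | act s x == x].

Fact stab_group_set x : group_set (stab x).
Proof.
apply/group_setP; split=> [|s t]; first by rewrite inE lact1.
by rewrite !inE => /eqP hs /eqP ht; rewrite lactM ht hs.
Qed.

Canonical stab_group x : {group gT} := Group (stab_group_set x).

Definition fully_stabilized (x : X) : Prop := forall y, #|stab y| <= #|stab x|.

(* In MathComp (a * b) x = b (a x) for permutations, so the composite
   "b after a" is a * b, and the composite s a s^-1 is a ^ s. *)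
Definition mcomp (v u : {ffun gT -> gT} * {perm X}) : {ffun gT -> gT} * {perm X} :=
  (hcomp v.1 u.1, u.2 * v.2).
Definition mid (P : {set gT}) : {ffun gT -> gT} * {perm X} := (pid P, 1).
Definition minv (P : {set gT}) (u : {ffun gT -> gT} * {perm X}) :=
  (pinv P u.1, u.2^-1).
Definition mconj (P : {set gT}) (s : gT) : {ffun gT -> gT} * {perm X} :=
  (lconj P s, ell s).

Definition intertwined P Q : {set {ffun gT -> gT} * {perm X}} :=
  [set u | (u.1 \in Inj P Q) && [forall a in P, ell a ^ u.2 == ell (u.1 a)]].

Definition misos_of
    (M : {group gT} -> {group gT} -> {set {ffun gT -> gT} * {perm X}}) P Q :=
  [set u in M P Q | [exists v in M Q P,
                       (mcomp v u == mid P) && (mcomp u v == mid Q)]].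

(* Identities belong to the category because the pairs (c_1, ell 1) do. *)
Record fusion_action_system := FusionActionSystem {
  fasys :> {group gT} -> {group gT} -> {set {ffun gT -> gT} * {perm X}};
  fas_conj : forall P Q s, s \in transp [set: gT] P Q -> mconj P s \in fasys P Q;
  fas_sub : forall P Q, fasys P Q \subset intertwined P Q;
  fas_comp : forall P Q R u v,
    u \in fasys P Q -> v \in fasys Q R -> mcomp v u \in fasys P R;
  fas_fact : forall P Q u, u \in fasys P Q ->
    exists R : {group gT}, R \subset Q /\
      exists2 v, v \in misos_of fasys P R & u = mcomp (mid R) v
}.

Variable XX : fusion_action_system.

Lemma fas_inj P Q u : u \in XX P Q -> u.1 \in Inj P Q.
Proof. by move/(subsetP (fas_sub XX P Q)); rewrite inE => /andP[]. Qed.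

Lemma fas_id P : mid P \in XX P P.
Proof.
have -> : mid P = mconj P 1.
  congr (_, _); first by apply/ffunP=> x; rewrite !ffunE invg1 mulg1 mul1g.
  by apply/permP=> x; rewrite perm1 permE lact1.
by apply: fas_conj; rewrite inE in_setT invg1 conjsg1 /=.
Qed.

(* The homomorphisms f such that (f, sg) is a morphism for some sg in D: for
   D = [set: {perm X}] this is the underlying fusion system, and for
   D = 'C[x | 'P], the stabilizer of x in {perm X}, it is F_x. *)
Definition shadow (D : {set {perm X}}) P Q : {set {ffun gT -> gT}} :=
  [set f | [exists sg in D, (f, sg) \in XX P Q]].

Section Shadow.

Variables (D : {group {perm X}}) (T : {group gT}).
Hypothesis ellD : forall t, t \in T -> ell t \in D.

Fact shadow_inj P Q : P \subset T -> Q \subset T -> shadow D P Q \subset Inj P Q.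
Proof.
by move=> _ _; apply/subsetP=> f; rewrite inE => /exists_inP[sg _ /fas_inj].
Qed.

Fact shadow_conj P Q t : P \subset T -> Q \subset T ->
  t \in transp T P Q -> lconj P t \in shadow D P Q.
Proof.
move=> _ _; rewrite !inE => /andP[tT tPQ]; apply/exists_inP; exists (ell t).
  exact: ellD.
by apply: (fas_conj XX); rewrite inE in_setT.
Qed.

Fact shadow_comp P Q R f g : P \subset T -> Q \subset T -> R \subset T ->
  f \in shadow D P Q -> g \in shadow D Q R -> hcomp g f \in shadow D P R.
Proof.
move=> _ _ _; rewrite !inE => /exists_inP[sf Df uf] /exists_inP[sg Dg ug].
apply/exists_inP; exists (sf * sg); first exact: groupM.
exact: (fas_comp uf ug).
Qed.

Fact shadow_fact P Q f : P \subset T -> Q \subset T -> f \in shadow D P Q ->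
  exists R : {group gT}, R \subset Q /\
    exists2 g, g \in isos_of (shadow D) P R & f = hcomp (pid R) g.
Proof.
move=> _ _; rewrite inE => /exists_inP[sg Dsg /fas_fact[R [RQ [[g t]]]]].
rewrite inE => /andP[vX /exists_inP[[g' t'] v'X]].
rewrite /mcomp /mid => /andP[/eqP[gg' tt'] /eqP[g'g _]] [-> ts].
have Dt : t \in D by rewrite -[t]mulg1 -ts.
have Dt' : t' \in D by rewrite -(groupMl _ Dt) tt' group1.
exists R; split=> //; exists g => //; rewrite !inE; apply/andP; split.
  by apply/exists_inP; exists t.
apply/exists_inP; exists g'; last by rewrite gg' g'g !eqxx.
by rewrite inE; apply/exists_inP; exists t'.
Qed.

Definition shadow_system : fusion_system T :=
  FusionSystem shadow_inj shadow_conj shadow_comp shadow_fact.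

End Shadow.

Fact under_subproof t : t \in [set: gT]%G -> ell t \in [set: {perm X}]%G.
Proof. by rewrite !inE. Qed.

Definition under : fusion_system [set: gT] := shadow_system under_subproof.

Fact stab_subproof x t : t \in stab_group x -> ell t \in 'C[x | 'P]%G.
Proof. by rewrite inE => /eqP tx; apply/astab1P; rewrite /= apermE permE. Qed.

Definition stab_fusion x : fusion_system (stab_group x) :=
  shadow_system (@stab_subproof x).

Definition Sigma P : {set {perm X}} := [set u.2 | u in XX P P].

(* Sigma 1 is the group XX(1) seen inside {perm X}. *)
Definition transitive_fas : Prop := [transitive Sigma 1%G, on [set: X] | 'P].

Section ActionSaturation.

Variable p : nat.

Definition fully_X_normalized := fully under (fun P => #|'N(P) :&: core|).
Definition fully_X_centralized := fully under (fun P => #|'C(P) :&: core|).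

Definition AutSX P : {set {ffun gT -> gT} * {perm X}} := [set mconj P s | s in 'N(P)].
Definition SigmaS P : {set {perm X}} := [set ell s | s in 'N(P)].
Definition FX0 P : {set {ffun gT -> gT}} := [set f | (f, 1) \in XX P P].
Definition FSX0 P : {set {ffun gT -> gT}} := [set lconj P s | s in 'N(P) :&: core].
Definition Sigma0 P : {set {perm X}} := [set sg | (pid P, sg) \in XX P P].
Definition SigmaS0 P : {set {perm X}} := [set ell s | s in 'C(P)].

Definition as_maut P (A : {set {ffun gT -> gT} * {perm X}}) :
    {set {perm gT} * {perm X}} :=
  [set u | (u.1 \in Aut P) && ((restr P u.1, u.2) \in A)].

Definition mextender P Q (u : {ffun gT -> gT} * {perm X}) : {set gT} :=
  [set n in 'N(P) | mcomp u (mcomp (mconj P n) (minv P u)) \in AutSX Q].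

(* As before, mextender P Q u is a subgroup and << >> only packages it. *)
Record fas_saturated : Prop := FasSaturated {
  fsat_norm : forall P, fully_normalized under P ->
    fully_X_normalized P /\ fully_centralized under P;
  fsat_Xnorm : forall P, fully_X_normalized P -> fully_X_centralized P;
  fsat_cent : forall P, fully_centralized under P -> fully_X_centralized P;
  fsat_sylow : forall P, fully_normalized under P ->
    [/\ p.-Sylow(as_aut P (under P P)) (as_aut P (AutIn [set: gT] P)),
        p.-Sylow(as_maut P (XX P P)) (as_maut P (AutSX P))
      & p.-Sylow(Sigma P) (SigmaS P)];
  fsat_sylowF : forall P, fully_X_normalized P ->
    p.-Sylow(as_aut P (FX0 P)) (as_aut P (FSX0 P));
  fsat_sylowS : forall P, fully_centralized under P ->
    p.-Sylow(Sigma0 P) (SigmaS0 P);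
  fsat_ext : forall P Q f sg, fully_X_centralized Q ->
    (f, sg) \in misos_of XX P Q ->
    exists2 f', (f', sg) \in XX <<mextender P Q (f, sg)>>%G [set: gT]%G
              & restr P f' = f
}.

End ActionSaturation.

Definition Xcentric : {set {group gT}} :=
  [set P | [forall Q : {group gT}, fconjugate under P Q ==>
              ('Z(Q) :&: core == 'C(Q) :&: core)]].

Section ActionCategory.

Variables (T : {group gT}) (H : {set {group gT}}).

Definition fas_hom (P Q : ob T H) : finType :=
  {u : {ffun gT -> gT} * {perm X} | u \in XX (obg P) (obg Q)}.
Definition fas1 (P : ob T H) : fas_hom P P := exist _ (mid (obg P)) (fas_id (obg P)).
Definition fasM (P Q R : ob T H) (v : fas_hom Q R) (u : fas_hom P Q) : fas_hom P R :=
  exist _ (mcomp (val v) (val u)) (fas_comp (valP u) (valP v)).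

(* The full subcategory of XX on the subgroups of T lying in H. *)
Definition fas_category : category (ob T H).
Proof.
refine (@Category _ fas_hom fas1 fasM _ _ _).
- move=> P Q u; apply: val_inj; rewrite /= /mcomp /= mulg1.
  by rewrite (hcomp1f (fas_inj (valP u))) -surjective_pairing.
- move=> P Q u; apply: val_inj; rewrite /= /mcomp /= mul1g.
  by rewrite (hcompf1 (fas_inj (valP u))) -surjective_pairing.
- by move=> P Q R W u v w; apply: val_inj; rewrite /= /mcomp /= hcompA mulgA.
Defined.

End ActionCategory.

Notation cX := (ob [set: gT] Xcentric).
Notation trcX := (transporter_category [set: gT] Xcentric).

(* In las_B, the morphism "hat a" is delta_{P,Q}(a) for a \in P and any Q
   containing P.  With Q = P only, the axioms would not force delta_{P,Q}(1)
   to act trivially on X, nor delta to restrict to the stabilizer of x. *)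
Record linking_action_system := LinkingActionSystem {
  lcat :> category cX;
  ldelta : functor trcX lcat;
  lpi : functor lcat (fas_category [set: gT] Xcentric);
  las_inj : forall P Q : cX, injective (ldelta P Q);
  las_surj : forall (P Q : cX) (u : hom (fas_category [set: gT] Xcentric) P Q),
    exists g : hom lcat P Q, lpi _ _ g = u;
  las_free : forall (P Q : cX) (g : hom lcat P Q) (z : hom trcX P P),
    val z \in 'Z(obg P) :&: core -> ccomp g (ldelta _ _ z) = g -> val z = 1;
  las_orbit : forall (P Q : cX) (g h : hom lcat P Q),
    lpi _ _ g = lpi _ _ h <->
    exists2 z : hom trcX P P,
      val z \in 'Z(obg P) :&: core & h = ccomp g (ldelta _ _ z);
  las_B : forall (P Q : cX) (a : hom trcX P Q), val a \in obg P ->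
    val (lpi _ _ (ldelta _ _ a)) = mconj (obg P) (val a);
  las_C : forall (P Q : cX) (g : hom lcat P Q) (a : hom trcX P P) (b : hom trcX Q Q),
    val a \in obg P -> val b = (val (lpi _ _ g)).1 (val a) ->
    ccomp (ldelta _ _ b) g = ccomp g (ldelta _ _ a)
}.

Section StabilizerLinking.

Variables (L : linking_action_system) (x : X).

Definition lperm (P Q : cX) (g : hom L P Q) : {perm X} := (val (lpi L _ _ g)).2.

Lemma lperm1 (P : cX) : lperm (cid L P) = 1.
Proof. by rewrite /lperm fmap1. Qed.

Lemma lpermM (P Q R : cX) (g : hom L P Q) (h : hom L Q R) :
  lperm (ccomp h g) = lperm g * lperm h.
Proof. by rewrite /lperm fmapM. Qed.

Lemma setT_centric : [set: gT]%G \in Xcentric.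
Proof.
rewrite inE; apply/forallP=> Q; apply/implyP=> /set0Pn[f].
rewrite inE => /andP[/(subsetP (fs_inj under (subsetT _) (subsetT _)))].
rewrite inE => /and4P[_ /dinjectiveP fI fQ _] _.
suff -> : Q :=: [set: gT] by rewrite /center setTI.
apply/eqP; rewrite eqEcard subsetT -(card_in_imset fI).
exact: subset_leq_card fQ.
Qed.

Definition topcX : cX :=
  exist _ [set: gT]%G (introT andP (conj setT_centric (subxx _))).

Fact to_top_subproof (P : cX) (s : gT) :
  s \in transp [set: gT] (obg P) (obg topcX).
Proof. by rewrite inE in_setT subsetT. Qed.

Definition to_top (P : cX) (s : gT) : hom trcX P topcX :=
  exist _ s (to_top_subproof P s).

Lemma lperm_delta (P Q : cX) (s : hom trcX P Q) :
  lperm (ldelta L _ _ s) = ell (val s).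
Proof.
have ell1 : ell 1 = 1 by apply/permP=> y; rewrite permE perm1 lact1.
have l1 (R : cX) : lperm (ldelta L _ _ (to_top R 1)) = 1.
  by rewrite /lperm las_B ?group1 //= ell1.
have lS : lperm (ldelta L _ _ (to_top topcX (val s))) = ell (val s).
  by rewrite /lperm las_B ?in_setT.
rewrite -[LHS]mulg1 -(l1 Q) -lpermM -fmapM -lS -[RHS]mul1g -(l1 P) -lpermM -fmapM.
by congr (lperm (ldelta L _ _ _)); apply: val_inj; rewrite /= mul1g mulg1.
Qed.

Notation cXx := (ob (stab_group x) Xcentric).
Notation trcXx := (transporter_category (stab_group x) Xcentric).

(* An X-centric subgroup of the stabilizer of x, as an object of L. *)
Definition up (P : cXx) : cX :=
  exist _ (obg P) (introT andP (conj (ob_mem P) (subsetT _))).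

Definition stab_hom (P Q : cXx) : finType :=
  {g : hom L (up P) (up Q) | lperm g x == x}.

Fact stab1_subproof (P : cXx) : lperm (cid L (up P)) x == x.
Proof. by rewrite lperm1 perm1. Qed.

Fact stabM_subproof (P Q R : cXx) (h : stab_hom Q R) (g : stab_hom P Q) :
  lperm (ccomp (val h) (val g)) x == x.
Proof. by rewrite lpermM permM (eqP (valP g)) (valP h). Qed.

Definition stab1 (P : cXx) : stab_hom P P := exist _ (cid L (up P)) (stab1_subproof P).
Definition stabM (P Q R : cXx) (h : stab_hom Q R) (g : stab_hom P Q) : stab_hom P R :=
  exist _ (ccomp (val h) (val g)) (stabM_subproof h g).

Definition stab_linking : category cXx.
Proof.
refine (@Category _ stab_hom stab1 stabM _ _ _).
- by move=> P Q g; apply: val_inj; rewrite /= ccomp1m.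
- by move=> P Q g; apply: val_inj; rewrite /= ccompm1.
- by move=> P Q R W g h k; apply: val_inj; rewrite /= ccompA.
Defined.

Fact up_tr_subproof (P Q : cXx) (s : hom trcXx P Q) :
  val s \in transp [set: gT] (obg (up P)) (obg (up Q)).
Proof. by case: s => s /=; rewrite !inE => /andP[]. Qed.

Definition up_tr (P Q : cXx) (s : hom trcXx P Q) : hom trcX (up P) (up Q) :=
  exist _ (val s) (up_tr_subproof s).

Fact stab_delta_subproof (P Q : cXx) (s : hom trcXx P Q) :
  lperm (ldelta L _ _ (up_tr s)) x == x.
Proof.
rewrite lperm_delta permE /=; case: s => s /=.
by rewrite !inE => /andP[].
Qed.

Definition stab_delta : functor trcXx stab_linking.
Proof.
refine (@Functor _ trcXx stab_linking
  (fun (P Q : cXx) s => exist _ (ldelta L _ _ (up_tr s)) (stab_delta_subproof s)) _ _).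
- move=> P; apply: val_inj; rewrite /= -(fmap1 (ldelta L)).
  by congr (ldelta L _ _ _); apply: val_inj.
- move=> P Q R s t; apply: val_inj; rewrite /= -(fmapM (ldelta L)).
  by congr (ldelta L _ _ _); apply: val_inj.
Defined.

Fact stab_pi_subproof (P Q : cXx) (g : hom stab_linking P Q) :
  (val (lpi L _ _ (val g))).1 \in stab_fusion x (obg P) (obg Q).
Proof.
rewrite inE; apply/exists_inP; exists (lperm (val g)).
  by apply/astab1P; rewrite /= apermE; apply/eqP; apply: valP g.
by have := valP (lpi L _ _ (val g)); rewrite /lperm; case: (val (lpi L _ _ _)).
Qed.

Definition stab_pi : functor stab_linking (fusion_category Xcentric (stab_fusion x)).
Proof.
refine (@Functor _ stab_linking (fusion_category Xcentric (stab_fusion x))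
  (fun (P Q : cXx) g => exist _ (val (lpi L _ _ (val g))).1 (stab_pi_subproof g)) _ _).
- by move=> P; apply: val_inj; rewrite /= fmap1.
- by move=> P Q R g h; apply: val_inj; rewrite /= fmapM.
Defined.

End StabilizerLinking.

End ActionSystems.

(* Main.v *)
Require Import Defs.
From mathcomp Require Import all_boot all_fingroup all_solvable.

Set Implicit Arguments.
Unset Strict Implicit.
Unset Printing Implicit Defensive.

Import GroupScope.
Local Open Scope group_scope.

(** Write X(P)_y for the stabilizer of y in X(P), and C for the kernel of the
    action of S on X.

    Saturation of F_x.  By a reduction of Roberts and Shpectorov
    ([receptive_saturated]) it is enough to find in each conjugacy class of F_x
    one subgroup Q' such that N_{S_x}(Q') induces a Sylow subgroup of F_x(Q') and
    isomorphisms into Q' extend as far as they should.  Two facts produce Q'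
    ([stab_receptive]).  First, as x is fully stabilized and X(1) is transitive,
    S_x induces a Sylow subgroup of X(1)_x; hence every S_y embeds in S_x by a
    morphism of X taking y to x ([stab_conjugate]).  Second, if Q is fully
    normalized then Aut_S(Q;X) is Sylow in X(Q), so every orbit of X(Q) on X has a
    point y for which Aut_S(Q;X) meets X(Q)_y in a Sylow subgroup
    ([inner_stab_Sylow]).  Starting from P in S_x, a fully normalized conjugate Q
    with such a y is transported back into S_x along the embedding of S_y.  A
    morphism of F_x remembers only the homomorphism, not the permutation of X;
    the permutation is recovered up to the kernel of X(Q')_x -> F_x(Q'), and
    Sylow's theorem in an intermediate group selects one for which the extension
    axiom of X applies ([stab_fusion_receptive]).

    The transporter axioms for L_x.  The subgroup S_x contains C and is therefore
    X-centric ([core_Xcentric]).  Freeness on both sides holds because an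
    endomorphism e with trivial homomorphism part and g e = g, or e g = g, has
    trivial permutation too, hence comes from Z(P;X), or from Z(Q;X), which
    axiom (C) moves to the other side ([las_monic], [las_epic]).  For axiom (I),
    L_x(S_x) maps to X(S_x)_x with kernel Z(S_x;X), and S_x induces a Sylow
    subgroup of X(S_x)_x since it is alone in its class ([top_inner_stab_Sylow],
    [delta_auts_Sylow]).  For axiom (II), X-centric subgroups are fully X-centralized, so the underlying
    isomorphism of X extends; a lift of the extension is corrected by an element
    of Z(P;X), which acts trivially on X ([las_extend]).

    Throughout, an isomorphism between subgroups is represented by the
    permutations of S that extend it.  Automorphism groups of all subgroups then
    lie in one finite group of pairs of permutations, where isomorphisms act by
    conjugation and Sylow's theorem can be applied directly. *)

(** * Isomorphisms as permutations of the ambient group *)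

Section PermutationExtensions.

Variable gT : finGroupType.
Implicit Types (P Q R H : {group gT}) (a b d : {perm gT}) (n : gT).

Lemma restr_in (P : {set gT}) (f : gT -> gT) y : y \in P -> restr P f y = f y.
Proof. by move=> yP; rewrite ffunE yP. Qed.

Lemma eq_restr (P : {set gT}) (f g : gT -> gT) :
  {in P, f =1 g} -> restr P f = restr P g.
Proof. by move=> fg; apply/ffunP=> y; rewrite !ffunE; case: ifP => // /fg. Qed.

Lemma restr_inj (P : {set gT}) (f g : gT -> gT) :
  restr P f = restr P g -> {in P, f =1 g}.
Proof. by move=> fg y yP; rewrite -(restr_in f yP) fg restr_in. Qed.

Lemma restr_restr (P Q : {set gT}) (f : gT -> gT) :
  P \subset Q -> restr P (restr Q f) = restr P f.
Proof. by move/subsetP=> PQ; apply: eq_restr => y /PQ; apply: restr_in. Qed.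

(** The complements of P and f(P) have the same size, so f can be completed by
    any bijection between them. *)
Lemma perm_extension (P : {set gT}) (f : gT -> gT) :
  {in P &, injective f} -> exists b, {in P, b =1 f}.
Proof.
move=> fI; pose A := enum (~: P); pose B := enum (~: (f @: P)).
have AB : size A = size B.
  by rewrite -!cardE (cardsCs (~: P)) (cardsCs (~: (f @: P))) !setCK
       (card_in_imset fI).
pose g y := if y \in P then f y else nth 1 B (index y A).
have gP y : y \in P -> g y = f y by rewrite /g => ->.
have gN y : y \notin P -> g y \notin f @: P.
  move=> yP; rewrite /g (negPf yP) -in_setC -mem_enum mem_nth // -AB index_mem.
  by rewrite mem_enum inE.
have gI : injective g.
  move=> y z gyz; have [yP|yP] := boolP (y \in P); have [zP|zP] := boolP (z \in P).
  - by apply: fI => //; rewrite -!gP.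
  - by have := gN _ zP; rewrite -gyz gP // imset_f.
  - by have := gN _ yP; rewrite gyz gP // imset_f.
  have yA : y \in A by rewrite mem_enum inE.
  have zA : z \in A by rewrite mem_enum inE.
  move: gyz; rewrite /g (negPf yP) (negPf zP) => /eqP.
  rewrite nth_uniq -?AB ?index_mem ?enum_uniq // => /eqP.
  by move=> e; rewrite -(nth_index 1 yA) e nth_index.
by exists (perm gI) => y yP; rewrite permE gP.
Qed.

Lemma hcomp_restr P Q R a b :
    a @: P \subset Q -> restr Q b \in Inj Q R ->
  hcomp (restr Q b) (restr P a) = restr P (a * b).
Proof.
move=> aPQ bI; apply/ffunP=> y; rewrite [LHS]ffunE ![in RHS]ffunE (ffunE _ y).
case: ifP => yP; last exact: Inj1 bI.
by rewrite restr_in ?permM // (subsetP aPQ) // imset_f.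
Qed.

Lemma Inj_morphic P Q b : restr P b \in Inj P Q -> morphic P b.
Proof.
rewrite inE => /and4P[fM _ _ _]; move/morphicP: fM => fM.
by apply/morphicP=> y z yP zP; rewrite -!(restr_in b (P := P)) ?groupM ?fM.
Qed.

Lemma Aut_Inj P a : a \in Aut P -> restr P a \in Inj P P.
Proof.
rewrite inE => /andP[aP aM]; rewrite inE; apply/and4P; split.
- move/morphicP: aM => aM.
  by apply/morphicP=> y z yP zP; rewrite !restr_in ?groupM ?aM.
- by apply/dinjectiveP=> y z yP zP; rewrite !restr_in //; apply: perm_inj.
- apply/subsetP=> _ /imsetP[y yP ->].
  by rewrite restr_in // (perm_closed _ aP).
- by apply/eqP; rewrite restr_restr.
Qed.

Lemma Aut_restr_inj P a b :
  a \in Aut P -> b \in Aut P -> restr P a = restr P b -> a = b.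
Proof. by move=> aA bA ab; apply: (eq_Aut aA bA); apply: restr_inj. Qed.

Lemma pinv_restr P b : pinv P (restr P b) = restr (b @: P) b^-1.
Proof.
apply/ffunP=> y; rewrite !ffunE; case: pickP => [z /andP[zP /eqP]|no] /=.
  by rewrite restr_in // => <-; rewrite imset_f // permK.
case: ifP => // /imsetP[z zP yz]; have := no z.
by rewrite zP restr_in // -yz eqxx.
Qed.

Lemma lconjE P n : n \in 'N(P) -> lconj P n = restr P (conj_aut P n^-1).
Proof.
move=> nP; apply: eq_restr => y yP.
by rewrite norm_conj_autE ?groupV // conjgE invgK mulgA.
Qed.

(** An automorphism of P, as a permutation fixing the complement of P, only
    sees the values on P of a permutation that conjugates it. *)
Lemma eq_conj_Aut P a b d : a \in Aut P -> {in P, b =1 d} -> a ^ b = a ^ d.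
Proof.
move=> aA bd; apply/permP=> y; have -> : y = b (b^-1 y) by rewrite permKV.
move: (b^-1 y) => z {y}; rewrite permJ; have [zP|zP] := boolP (z \in P).
  by rewrite (bd z zP) permJ -bd // (Aut_closed aA).
rewrite (out_Aut aA zP).
have : d^-1 (b z) \notin P.
  by apply: contra zP => dP; have:= bd _ dP; rewrite permKV => /perm_inj <-.
move: (d^-1 (b z)) (permKV d (b z)) => t <- tP.
by rewrite permJ (out_Aut aA tP).
Qed.

Lemma morphic_norm (H R : {group gT}) (Q : {set gT}) d n :
    morphic H d -> R \subset H -> d @: R = Q -> n \in H -> n \in 'N(R) ->
  d n \in 'N(Q).
Proof.
move=> /morphicP dM RH <- nH nR.
suff N m : m \in H -> m \in 'N(R) -> (d @: R) :^ (d m) \subset d @: R.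
  by rewrite inE N.
move=> mH mR; apply/subsetP=> _ /imsetP[_ /imsetP[y yR ->] ->].
have yH := subsetP RH y yR.
have <- : d (y ^ m) = d y ^ d m.
  by apply: (mulgI (d m)); rewrite -conjgC -!dM ?groupJ // -conjgC.
by apply: imset_f; rewrite memJ_norm.
Qed.

(** A homomorphism d carries the conjugation action of n on R to that of d(n)
    on d(R).  Every compatibility between normalizers and isomorphisms comes
    from this identity, read inside the group of permutations of gT. *)
Lemma conj_aut_morphic (H R Q : {group gT}) d n :
    morphic H d -> R \subset H -> d @: R = Q -> n \in H -> n \in 'N(R) ->
  conj_aut R n ^ d = conj_aut Q (d n).
Proof.
move=> dM RH dR nH nR; have dnQ := morphic_norm dM RH dR nH nR.
move/morphicP: dM => dM.
apply/permP=> y; have -> : y = d (d^-1 y) by rewrite permKV.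
move: (d^-1 y) => z {y}; rewrite permJ.
have [zR|zR] := boolP (z \in R).
  have zH := subsetP RH z zR.
  rewrite !norm_conj_autE -?dR ?imset_f // ?dR //.
  by apply: (mulgI (d n)); rewrite -conjgC -!dM ?groupJ // -conjgC.
rewrite (out_Aut (Aut_aut _ _) zR) (out_Aut (Aut_aut _ _)) //.
by rewrite -dR mem_imset //; apply: perm_inj.
Qed.

Lemma Aut_conj R Q a b :
  morphic R b -> b @: R = Q -> a \in Aut R -> a ^ b \in Aut Q.
Proof.
move=> /morphicP bM bR aA; have az z : z \in R -> a z \in R.
  by move=> zR; rewrite (Aut_closed aA).
rewrite inE; apply/andP; split.
  apply/subsetP=> y; rewrite inE; have -> : y = b (b^-1 y) by rewrite permKV.
  move: (b^-1 y) => z {y}; rewrite permJ -bR => ne.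
  have [zR|zR] := boolP (z \in R); first exact: imset_f.
  by rewrite (out_Aut aA zR) eqxx in ne.
apply/morphicP=> y t; rewrite -bR => /imsetP[z zR ->] /imsetP[w wR ->].
move: aA; rewrite inE => /andP[_ /morphicP aM].
by rewrite -bM // !permJ aM ?bM ?az.
Qed.

Lemma morphim_conj_aut (H R Q A : {group gT}) d :
    morphic H d -> R \subset H -> d @: R = Q -> A \subset H -> A \subset 'N(R) ->
  (conj_aut R @* A) :^ d = conj_aut Q @* (d @: A).
Proof.
move=> dM RH dR AH AN.
have dAN : d @: A \subset 'N(Q).
  apply/subsetP=> _ /imsetP[n nA ->].
  exact: morphic_norm dM RH dR (subsetP AH n nA) (subsetP AN n nA).
rewrite !morphimEsub // -[_ :^ d]/(conjg^~ d @: _) -!imset_comp.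
apply: eq_in_imset => n nA /=.
exact: conj_aut_morphic dM RH dR (subsetP AH n nA) (subsetP AN n nA).
Qed.

Lemma Inj_conj_restr R Q b n :
    restr R b \in Inj R Q -> b @: R = Q -> n \in 'N(R) ->
  hcomp (restr R b) (hcomp (lconj R n) (pinv R (restr R b))) =
    restr Q (conj_aut R n^-1 ^ b).
Proof.
move=> bI bR nR; have cR : conj_aut R n^-1 \in Aut R by apply: Aut_aut.
rewrite lconjE // pinv_restr bR.
have bQ : b^-1 @: Q = R.
  rewrite -bR -imset_comp -[RHS]imset_id; apply: eq_imset => y.
  by rewrite /= permK.
rewrite (hcomp_restr (Q := R) (R := R)) ?bQ ?Aut_Inj //.
rewrite (hcomp_restr (Q := R) (R := Q)) //; first by rewrite conjgE mulgA.
apply/subsetP=> _ /imsetP[y yQ ->].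
by rewrite permM (Aut_closed cR) // -bQ imset_f.
Qed.

Lemma Inj_Aut P f : f \in Inj P P ->
  exists2 a, a \in Aut P & restr P a = f.
Proof.
rewrite inE => /and4P[fM /dinjectiveP fI fP /eqP fr].
have [b bf] := perm_extension fI; have bP : b @: P = P.
  apply/eqP; rewrite eqEcard (card_imset _ (@perm_inj _ b)) leqnn andbT.
  by rewrite (eq_in_imset bf).
have bN : b \in 'N(P | 'P).
  by apply/astabsP=> y; rewrite /= apermE -{1}bP mem_imset //; apply: perm_inj.
have rb y : y \in P -> restr_perm P b y = f y by move=> yP; rewrite restr_permE ?bf.
exists (restr_perm P b); last by rewrite fr; apply: eq_restr.
rewrite inE restr_perm_on; move/morphicP: fM => fM.
by apply/morphicP=> y z yP zP; rewrite !rb ?groupM ?fM.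
Qed.

Definition aut_of P (f : {ffun gT -> gT}) : {perm gT} :=
  odflt 1 [pick a in Aut P | restr P a == f].

Lemma aut_ofP P f : f \in Inj P P ->
  aut_of P f \in Aut P /\ restr P (aut_of P f) = f.
Proof.
rewrite /aut_of; case: pickP => [a /andP[aA /eqP af] _ //|no /Inj_Aut[a aA af]].
by have := no a; rewrite aA af eqxx.
Qed.

End PermutationExtensions.

(** * Isomorphisms of a fusion system *)

Section FusionIsomorphisms.

Variables (gT : finGroupType) (T : {group gT}) (E : fusion_system T).
Implicit Types (P Q R H K : {group gT}) (a b d : {perm gT}) (n : gT).

Lemma fs_injP P Q f : P \subset T -> Q \subset T -> f \in E P Q -> f \in Inj P Q.
Proof. by move=> PT QT; apply/subsetP; apply: fs_inj. Qed.

Lemma fs_incl P Q : P \subset Q -> Q \subset T -> pid P \in E P Q.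
Proof.
move=> PQ QT; have -> : pid P = lconj P 1.
  by apply/ffunP=> y; rewrite !ffunE invg1 mulg1 mul1g.
by apply: fs_conj; rewrite ?(subset_trans PQ) // inE group1 invg1 conjsg1.
Qed.

Lemma isos_ofP P Q f : P \subset T -> Q \subset T ->
  reflect (f \in E P Q /\ f @: P = Q) (f \in isos_of E P Q).
Proof.
have iso_im R K (g : {ffun gT -> gT}) : R \subset T -> K \subset T ->
    g \in isos_of E R K -> g \in E R K /\ g @: R = K.
  move=> RT KT; rewrite inE => /andP[gE /exists_inP[g' g'E /andP[_ /eqP gg']]].
  split=> //; have /fs_injP-/(_ RT KT) := gE; rewrite inE => /and4P[_ _ gRK _].
  apply/eqP; rewrite eqEsubset gRK; apply/subsetP=> y yK.
  have -> : y = g (g' y) by have /ffunP/(_ y) := gg'; rewrite !ffunE yK.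
  by rewrite imset_f // (Inj_in _ (fs_injP KT RT g'E)).
move=> PT QT; apply: (iffP idP) => [|[fE fPQ]]; first exact: iso_im.
have [K [KQ [g gI fg]]] := fs_fact PT QT fE.
have KT := subset_trans KQ QT; have [gE gK] := iso_im _ _ _ PT KT gI.
have eqfg : f = g by rewrite fg (hcomp1f (fs_injP PT KT gE)).
suff -> : Q = K by rewrite eqfg.
by apply: val_inj; rewrite /= -fPQ -gK eqfg.
Qed.

(** Each isomorphism is represented by all the permutations of the ambient
    group that extend it, so that isomorphisms can be composed, inverted and
    made to act by conjugation inside one group. *)
Definition fiso P Q : {set {perm gT}} :=
  [set b : {perm gT} | (b @: P == Q) && (restr P b \in E P Q)].

Lemma fiso_im P Q b : b \in fiso P Q -> b @: P = Q.
Proof. by rewrite inE => /andP[/eqP]. Qed.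

Lemma fiso_morphic P Q b : P \subset T -> Q \subset T ->
  b \in fiso P Q -> morphic P b.
Proof.
by move=> PT QT; rewrite inE => /andP[_ /fs_injP-/(_ PT QT)/Inj_morphic].
Qed.

Lemma fiso_card P Q b : b \in fiso P Q -> #|P| = #|Q|.
Proof. by move/fiso_im <-; rewrite card_imset //; apply: perm_inj. Qed.

Lemma fisoP P Q b : P \subset T -> Q \subset T ->
  (b \in fiso P Q) = (restr P b \in isos_of E P Q).
Proof.
move=> PT QT; rewrite inE; apply/andP/isos_ofP=> // [[/eqP bP bE]|[bE bP]].
  by split=> //; rewrite -bP; apply: eq_in_imset => y; apply: restr_in.
by split=> //; rewrite -bP eq_sym; apply/eqP/eq_in_imset=> y; apply: restr_in.
Qed.

Lemma isos_of_fiso P Q f : P \subset T -> Q \subset T -> f \in isos_of E P Q ->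
  exists2 b, b \in fiso P Q & f = restr P b.
Proof.
move=> PT QT fI; have /isos_ofP-/(_ PT QT)[fE _] := fI.
have := fs_injP PT QT fE; rewrite inE => /and4P[_ /dinjectiveP f_inj _ /eqP fr].
have [b bf] := perm_extension f_inj.
have fb : f = restr P b by rewrite fr; apply: eq_restr => y /bf.
by exists b; rewrite // fisoP // -fb.
Qed.

Lemma fconjugateP P Q : P \subset T -> Q \subset T ->
  reflect (exists b, b \in fiso P Q) (fconjugate E P Q).
Proof.
move=> PT QT; apply: (iffP (set0Pn _)) => [[f /isos_of_fiso[]// b]|[b]].
  by exists b.
by rewrite fisoP // => bI; exists (restr P b).
Qed.

Lemma fisoM P Q R a b : P \subset T -> Q \subset T -> R \subset T ->
  a \in fiso P Q -> b \in fiso Q R -> a * b \in fiso P R.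
Proof.
move=> PT QT RT; rewrite !inE => /andP[/eqP aP aE] /andP[/eqP bQ bE].
rewrite -(hcomp_restr (Q := Q) (R := R)) ?(fs_injP QT RT) ?aP // (fs_comp PT QT) //.
rewrite -bQ -aP -imset_comp andbT; apply/eqP/eq_imset => y.
by rewrite /= permM.
Qed.

Lemma fisoV P Q b : P \subset T -> Q \subset T ->
  b \in fiso P Q -> b^-1 \in fiso Q P.
Proof.
move=> PT QT bI; have bP := fiso_im bI.
have : restr P b \in isos_of E P Q by rewrite -fisoP.
rewrite !inE => /andP[_ /exists_inP[g gE /andP[/eqP gb _]]].
rewrite -bP -imset_comp; apply/andP; split.
  by apply/eqP; rewrite -[RHS]imset_id; apply: eq_imset => y; rewrite /= permK.
suff -> : restr (b @: P) b^-1 = g by [].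
have gI := fs_injP QT PT gE; have gr : g = restr Q g.
  by apply/eqP; move: gI; rewrite inE => /and4P[].
rewrite gr bP; apply: eq_restr => z; rewrite -bP => /imsetP[y yP ->].
by have /ffunP/(_ y) := gb; rewrite !ffunE yP permK.
Qed.

Lemma fiso_sub P Q R b : P \subset T -> Q \subset T -> R \subset P ->
  b \in fiso P Q -> exists2 K : {group gT}, K \subset Q & b \in fiso R K.
Proof.
move=> PT QT RP bI; have RT := subset_trans RP PT.
have : hcomp (restr P b) (pid R) \in E R Q.
  by apply: fs_comp (fs_incl RP PT) _ => //; move: bI; rewrite inE => /andP[].
have bJ := bI; rewrite inE in bJ; have {bJ} /andP[_ bE] := bJ.
have -> : hcomp (restr P b) (pid R) = restr R b.
  apply/ffunP=> y; rewrite [LHS]ffunE [RHS]ffunE (ffunE _ y).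
  case: ifP => [yR|_]; last exact: Inj1 (fs_injP PT QT bE).
  by rewrite restr_in // (subsetP RP).
case/(fs_fact RT QT)=> K [KQ [g gI bg]].
have KT := subset_trans KQ QT; exists K => //; rewrite fisoP //.
have /isos_ofP-/(_ RT KT)[gE _] := gI.
by rewrite bg (hcomp1f (fs_injP RT KT gE)).
Qed.

Lemma fiso_widen P Q R b : P \subset T -> Q \subset R -> R \subset T ->
  b \in fiso P Q -> restr P b \in E P R.
Proof.
move=> PT QR RT; have QT := subset_trans QR RT; rewrite inE => /andP[_ bE].
have := fs_comp PT QT RT bE (fs_incl QR RT).
by rewrite (@hcomp1f _ P) //; apply: fs_injP.
Qed.

Lemma eq_fiso P Q a b : {in P, a =1 b} -> (a \in fiso P Q) = (b \in fiso P Q).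
Proof. by move=> ab; rewrite !inE (eq_in_imset ab) (eq_restr ab). Qed.

Lemma fiso1 P : P \subset T -> 1 \in fiso P P.
Proof.
move=> PT; rewrite inE; apply/andP; split.
  by apply/eqP; rewrite -[RHS]imset_id; apply: eq_imset => y; rewrite perm1.
have -> : restr P (1 : {perm gT}) = pid P by apply: eq_restr => y; rewrite perm1.
exact: fs_incl.
Qed.

Definition faut P : {set {perm gT}} := as_aut P (E P P).

Lemma fautE P : faut P = Aut P :&: fiso P P.
Proof.
apply/setP=> a; rewrite [in RHS]inE [LHS]inE; apply: andb_id2l.
by rewrite {1}inE => /andP[/im_perm_on aP _]; rewrite inE aP eqxx.
Qed.

End FusionIsomorphisms.

(** * Saturation from receptive subgroups *)

Section ReceptiveSubgroups.

Variables (gT : finGroupType) (T : {group gT}) (E : fusion_system T).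
Implicit Types (P Q R H K : {group gT}) (a b d : {perm gT}) (n : gT).

Lemma fautJ P Q b : P \subset T -> Q \subset T -> b \in fiso E P Q ->
  faut E P :^ b = faut E Q.
Proof.
have sub R K d : R \subset T -> K \subset T -> d \in fiso E R K ->
    faut E R :^ d \subset faut E K.
  move=> RT KT dI; apply/subsetP=> _ /imsetP[a aA ->].
  move: aA; rewrite fautE => /setIP[aA aI].
  rewrite fautE inE (Aut_conj (fiso_morphic RT KT dI) (fiso_im dI) aA) /=.
  rewrite conjgE; have dV := fisoV RT KT dI.
  by rewrite (fisoM KT RT KT) // (fisoM RT RT KT).
move=> PT QT bI; apply/eqP; rewrite eqEsubset sub //= -sub_conjgV sub //.
exact: fisoV.
Qed.

Fact faut_group_set P : P \subset T -> group_set (faut E P).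
Proof.
move=> PT; rewrite fautE; apply/group_setP; split=> [|a b].
  by rewrite inE group1 fiso1.
by case/setIP=> aA aI /setIP[bA bI]; rewrite inE groupM // (fisoM PT PT PT).
Qed.

Lemma as_aut_AutIn P : as_aut P (AutIn T P) = conj_aut P @* 'N_T(P).
Proof.
apply/setP=> a; rewrite inE; apply/andP/idP=> [[aA /imsetP[n nNT]]|].
  have /setIP[nT nN] := nNT; rewrite lconjE // => /Aut_restr_inj -> //.
    by rewrite mem_morphim ?groupV.
  exact: Aut_aut.
case/morphimP=> n nN /setIP[nT _] ->; split; first exact: Aut_aut.
apply/imsetP; exists n^-1; first by rewrite inE !groupV nT.
by rewrite lconjE ?groupV // invgK.
Qed.

Lemma conj_aut_sub_faut P : P \subset T -> conj_aut P @* 'N_T(P) \subset faut E P.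
Proof.
move=> PT; rewrite -as_aut_AutIn; apply/subsetP=> a; rewrite !inE => /andP[-> /=].
case/imsetP=> n /setIP[nT nP] ->; apply: fs_conj => //.
by rewrite inE nT /= sub_conjgV (normP nP).
Qed.

Lemma mem_extender R Q b n : restr R b \in Inj R Q -> b @: R = Q ->
  (n \in extender T R Q (restr R b)) =
    (n \in 'N_T(R)) && (conj_aut R n ^ b \in conj_aut Q @* 'N_T(Q)).
Proof.
move=> bI bR; rewrite inE; apply: andb_id2l => /setIP[_ nR].
rewrite (Inj_conj_restr bI bR) //.
have cA : conj_aut R n^-1 ^ b \in Aut Q.
  by rewrite (Aut_conj (Inj_morphic bI) bR) // Aut_aut.
transitivity (conj_aut R n^-1 ^ b \in as_aut Q (AutIn T Q)).
  by rewrite inE cA.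
by rewrite as_aut_AutIn morphV // conjVg groupV.
Qed.

Definition fully_automized p Q := p.-Sylow(faut E Q) (conj_aut Q @* 'N_T(Q)).

Definition receptive Q := forall R H b,
    R \subset T -> b \in fiso E R Q -> R \subset H -> H \subset 'N_T(R) ->
    conj_aut R @* H :^ b \subset conj_aut Q @* 'N_T(Q) ->
  exists d K, [/\ K \subset T, d \in fiso E H K & {in R, d =1 b}].

Variable p : nat.
Hypothesis pT : p.-group T.

(** Sylow's theorem in E(Q) lets an isomorphism onto such a Q be chosen
    compatible with the action of N_T(P), so that it extends to N_T(P). *)
Lemma receptive_norm P Q b : P \subset T -> Q \subset T ->
    fully_automized p Q -> receptive Q -> b \in fiso E P Q ->
  exists d K, [/\ K \subset 'N_T(Q), d \in fiso E 'N_T(P) K,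
                  d \in fiso E P Q & d @: 'C_T(P) = 'C_K(Q)].
Proof.
move=> PT QT sylQ recQ bI; pose AQ := Group (faut_group_set QT).
have pA : p.-group (conj_aut P @* 'N_T(P) :^ b).
  by rewrite /= pgroupJ morphim_pgroup // (pgroupS (subsetIl _ _) pT).
have sA : conj_aut P @* 'N_T(P) :^ b \subset AQ.
  by rewrite /= -(fautJ PT QT bI) conjSg conj_aut_sub_faut.
have [a aA sJ] := Sylow_Jsub (G := AQ) sylQ sA pA.
have baI : b * a \in fiso E P Q.
  by apply: fisoM bI _ => //; move: aA; rewrite /= fautE => /setIP[].
have sPN : P \subset 'N_T(P) by rewrite subsetI PT normG.
have [|d [K [KT dI db]]] := recQ P 'N_T(P)%G (b * a) PT baI sPN (subxx _).
  by rewrite conjsgM.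
have NT : 'N_T(P) \subset T by rewrite subsetIl.
have dQ : d \in fiso E P Q by rewrite (eq_fiso E Q db).
have dM := fiso_morphic NT KT dI.
have KE : K :=: d @: 'N_T(P) by rewrite (fiso_im dI).
have dN n : n \in 'N_T(P) -> d n \in 'N_T(Q).
  move=> nN; have /setIP[_ nP] := nN; rewrite inE.
  rewrite (morphic_norm dM sPN (fiso_im dQ)) // andbT (subsetP KT) //.
  by rewrite KE imset_f.
exists d, K; split=> //.
  by apply/subsetP=> y; rewrite KE => /imsetP[n nN ->]; apply: dN.
have dC n : n \in 'N_T(P) -> (d n \in 'C(Q)) = (n \in 'C(P)).
  move=> nN; have /setIP[_ nP] := nN; have /setIP[_ dnQ] := dN n nN.
  rewrite -!ker_conj_aut (sameP (kerP _ nP) eqP) (sameP (kerP _ dnQ) eqP).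
  rewrite /= -(conj_aut_morphic dM sPN (fiso_im dQ)) //.
  by rewrite conjg_eq1.
have CN : 'C_T(P) \subset 'N_T(P) by rewrite setIS // cent_sub.
apply/setP=> y; rewrite inE KE; apply/imsetP/andP=> [[n nC ->]|[/imsetP[n nN ->]]].
  have nN := subsetP CN n nC.
  by rewrite imset_f // dC //; case/setIP: nC.
by rewrite dC // => nC; exists n; rewrite // inE nC; case/setIP: nN => ->.
Qed.

(** The reduction of Roberts and Shpectorov.  Let Q be the given subgroup in the
    class of P, and d an isomorphism from P to Q extended to N_T(P).  If P is
    fully normalized, d maps N_T(P) onto N_T(Q) and carries the Sylow property
    and the order of the centralizer from Q to P.  If P is only fully
    centralized, d still maps C_T(P) onto C_T(Q); to extend r : R -> P, extend
    the composite of r with d and undo d: the image of the extension lies in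
    d(N_T(P)) because it acts on Q as d(N_T(P)) does, up to
    C_T(Q) = d(C_T(P)). *)
Theorem receptive_saturated :
    (forall P, P \subset T -> exists Q b,
      [/\ Q \subset T, b \in fiso E P Q, fully_automized p Q & receptive Q]) ->
  saturated p E.
Proof.
move=> good.
have class_card P Q b : P \subset T -> Q \subset T -> fully_automized p Q ->
    receptive Q -> b \in fiso E P Q -> #|'C_T(P)| <= #|'C_T(Q)|.
  move=> PT QT sQ rQ /(receptive_norm PT QT sQ rQ)[d [K [KN _ _ dC]]].
  rewrite -(card_imset _ (@perm_inj _ d)) dC subset_leq_card // setSI //.
  exact: subset_trans KN (subsetIl _ _).
have normal_good P : P \subset T -> fully_normalized E P -> exists Q d,
    [/\ Q \subset T, fully_automized p Q, receptive Q, d \in fiso E P Q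
       & d \in fiso E 'N_T(P) 'N_T(Q) /\ d @: 'C_T(P) = 'C_T(Q)].
  move=> PT nP; have [Q [b [QT bI sQ rQ]]] := good P PT.
  have [d [K [KN dN dI dC]]] := receptive_norm PT QT sQ rQ bI.
  have eKN : K :=: 'N_T(Q).
    apply/eqP; rewrite eqEcard KN -(fiso_card dN).
    by apply: nP => //; apply/fconjugateP=> //; exists d.
  exists Q, d; split=> //; split; last first.
    by rewrite dC eKN -setIA (setIidPr (cent_sub _)).
  by have -> : 'N_T(Q)%G = K by apply: val_inj.
split.
- move=> P PT nP R RT /fconjugateP-/(_ PT RT)[r rI].
  have [Q [d [QT sQ rQ dI [_ dC]]]] := normal_good P PT nP.
  rewrite -(card_imset 'C_T(P) (@perm_inj _ d)) dC.
  by apply: class_card (fisoM RT PT QT (fisoV PT RT rI) dI).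
- move=> P PT nP; rewrite as_aut_AutIn -/(faut E P).
  have [Q [d [QT sQ rQ dI [dN _]]]] := normal_good P PT nP.
  rewrite -[pHall _ _ _](pHallJ2 p (Group (faut_group_set PT))
    (conj_aut P @* 'N_T(P))%G d) /= (fautJ PT QT dI).
  have NT : 'N_T(P) \subset T by rewrite subsetIl.
  have NQT : 'N_T(Q) \subset T by rewrite subsetIl.
  rewrite (morphim_conj_aut (fiso_morphic NT NQT dN) _ (fiso_im dI)) ?subsetIr //.
    by rewrite (fiso_im dN).
  by rewrite subsetI PT normG.
move=> R P f RT PT cP /isos_of_fiso-/(_ RT PT)[r rI ->].
set N := <<_>>%G; have [Q [b0 [QT b0I sQ rQ]]] := good P PT.
have [d [K [KN dN dI dC]]] := receptive_norm PT QT sQ rQ b0I.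
have KT := subset_trans KN (subsetIl _ _).
have NT : 'N_T(P) \subset T by rewrite subsetIl.
have dM := fiso_morphic NT KT dN.
have PN : P \subset 'N_T(P) by rewrite subsetI PT normG.
have dAut n : n \in 'N_T(P) -> conj_aut P n ^ d = conj_aut Q (d n).
  move=> /[dup] nN /setIP[_ nP].
  exact (conj_aut_morphic dM PN (fiso_im dI) nN nP).
have dNQ n : n \in 'N_T(P) -> d n \in 'N_T(Q).
  by move=> nN; rewrite (subsetP KN) // -(fiso_im dN) imset_f.
have rInj : restr R r \in Inj R P.
  by move: rI; rewrite inE => /andP[_ /fs_injP]; apply.
have memN n : n \in N -> n \in 'N_T(R) /\ conj_aut R n ^ r \in conj_aut P @* 'N_T(P).
  have : N \subset 'N_T(R) :&: (conj_aut R @*^-1 (conj_aut P @* 'N_T(P) :^ r^-1)).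
    rewrite gen_subG; apply/subsetP=> m; rewrite mem_extender // ?(fiso_im rI) //.
    case/andP=> mN mP; have /setIP[_ mR] := mN.
    by apply/setIP; split=> //; apply/morphpreP; rewrite mem_conjgV.
  move/subsetP=> sN /sN /setIP[-> /morphpreP[nR]].
  by rewrite mem_conjgV.
have RN : R \subset N.
  apply: subset_trans (subset_gen _); apply/subsetP=> n nR.
  rewrite mem_extender // ?(fiso_im rI) // inE (subsetP RT) //= (subsetP (normG R)) //=.
  rewrite (conj_aut_morphic (Inj_morphic rInj) (subxx R) (fiso_im rI)) //; last first.
    exact: (subsetP (normG R)).
  have rnP : r n \in P by rewrite -(fiso_im rI) imset_f.
  rewrite mem_morphim ?(subsetP (normG P)) // inE (subsetP PT) //=.
  by rewrite (subsetP (normG P)).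
have NsNT : N \subset 'N_T(R) by apply/subsetP=> n /memN[].
have NsT := subset_trans NsNT (subsetIl _ _).
have rdI := fisoM RT PT QT rI dI.
have [|e [K' [K'T eI erd]]] := rQ R N (r * d) RT rdI RN NsNT.
  rewrite conjsgM; apply: subset_trans (_ : conj_aut P @* 'N_T(P) :^ d \subset _).
    rewrite conjSg sub_conjg; apply/subsetP=> _ /morphimP[n nR /memN[_ nP] ->].
    by rewrite mem_conjgV.
  apply/subsetP=> _ /imsetP[_ /morphimP[n nP nN ->] ->].
  rewrite dAut // mem_morphim ?dNQ //.
  by have /setIP[] := dNQ n nN.
have eM := fiso_morphic NsT K'T eI.
have eQ : e @: R = Q by rewrite (eq_in_imset erd) (fiso_im rdI).
have K'K : K' \subset K.
  apply/subsetP=> y; rewrite -(fiso_im eI) => /imsetP[n nN ->].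
  have [nNT nP] := memN n nN; have /setIP[_ nR] := nNT.
  have enT : e n \in T by rewrite (subsetP K'T) // -(fiso_im eI) imset_f.
  have enQ := morphic_norm eM RN eQ nN nR.
  have := conj_aut_morphic eM RN eQ nN nR.
  rewrite (eq_conj_Aut _ erd) ?Aut_aut // conjgM.
  case/morphimP: nP => m mP mN ->; rewrite dAut // => mn.
  have dmK : d m \in K by rewrite -(fiso_im dN) imset_f.
  have /setIP[dmT dmQ] := dNQ m mN.
  rewrite -(mulgKV (d m) (e n)) groupMr //.
  have : e n * (d m)^-1 \in 'C_K(Q) -> e n * (d m)^-1 \in K by case/setIP.
  apply; rewrite -dC; have cPQ : #|'C_T(P)| = #|'C_T(Q)|.
    apply/eqP; rewrite eqn_leq (class_card P Q d) //=.
    by apply: cP => //; apply/fconjugateP=> //; exists d.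
  have -> : d @: 'C_T(P) = 'C_T(Q).
    apply/eqP; rewrite eqEcard (card_imset _ (@perm_inj _ d)) cPQ leqnn andbT.
    by rewrite dC setSI.
  rewrite inE groupM ?groupV //= -ker_conj_aut.
  apply/kerP; first by rewrite groupM ?groupV.
  by rewrite morphM ?groupV // morphV //= -mn mulgV.
have dVN := fisoV NT KT dN.
have [K'' K''N dV] := fiso_sub KT NT K'K dVN.
have K''T := subset_trans K''N NT.
have edI := fisoM NsT K'T K''T eI dV.
exists (restr N (e * d^-1)); first exact: fiso_widen NsT K''T (subxx T) edI.
by rewrite restr_restr //; apply: eq_restr => y yR; rewrite permM erd // permM permK.
Qed.

End ReceptiveSubgroups.

(** * Isomorphisms of a fusion action system *)

Section ActionIsomorphisms.

Variables (gT : finGroupType) (X : finType) (act : left_action gT X).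
Variable XX : fusion_action_system act.
Implicit Types (P Q R H K : {group gT}) (b : {perm gT}) (s : {perm X}).
Implicit Types (n : gT) (u v w : {perm gT} * {perm X}).

Lemma ell1 : ell act 1 = 1.
Proof. by apply/permP=> y; rewrite permE perm1 lact1. Qed.

(** Products of permutations are written in diagrammatic order, which makes ell an
    antihomomorphism. *)
Lemma ellM n m : ell act (n * m) = ell act m * ell act n.
Proof. by apply/permP=> y; rewrite permM !permE lactM. Qed.

Lemma ellV n : ell act n^-1 = (ell act n)^-1.
Proof. by apply: (mulgI (ell act n)); rewrite -ellM mulVg ell1 mulgV. Qed.

Lemma fas_incl P Q : P \subset Q -> mid X P \in XX P Q.
Proof.
move=> PQ; have -> : mid X P = mconj act P 1.
  rewrite /mid /mconj ell1; congr (_, _).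
  by apply/ffunP=> y; rewrite !ffunE invg1 mulg1 mul1g.
by apply: fas_conj; rewrite !inE invg1 conjsg1.
Qed.

Lemma mcomp1f P Q (u : {ffun gT -> gT} * {perm X}) : u.1 \in Inj P Q -> mcomp (mid X Q) u = u.
Proof.
by move=> uI; rewrite /mcomp /mid /= mulg1 (hcomp1f uI) -surjective_pairing.
Qed.

Lemma misos_ofP P Q f s :
  reflect ((f, s) \in XX P Q /\ f @: P = Q) ((f, s) \in misos_of XX P Q).
Proof.
have iso_im R K g t : (g, t) \in misos_of XX R K -> (g, t) \in XX R K /\ g @: R = K.
  rewrite inE => /andP[gE /exists_inP[[g' t'] g'E /andP[_ /eqP[gg' _]]]].
  split=> //; have := fas_inj gE; rewrite inE => /and4P[_ _ gRK _].
  apply/eqP; rewrite eqEsubset gRK; apply/subsetP=> y yK.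
  have -> : y = g (g' y) by have /ffunP/(_ y) := gg'; rewrite !ffunE yK.
  by rewrite imset_f // (Inj_in _ (fas_inj g'E)).
apply: (iffP idP) => [|[fE fPQ]]; first exact: iso_im.
have [K [KQ [[g t] gI fg]]] := fas_fact fE.
have [gE gK] := iso_im _ _ _ _ gI; rewrite (mcomp1f (fas_inj gE)) in fg.
have -> : Q = K by apply: val_inj; rewrite /= -fPQ -gK; case: fg => ->.
by rewrite fg.
Qed.

(** As in [fiso], all the permutations extending a homomorphism are kept. *)
Definition miso P Q : {set {perm gT} * {perm X}} :=
  [set u : {perm gT} * {perm X} | (u.1 @: P == Q) && ((restr P u.1, u.2) \in XX P Q)].

Lemma miso_im P Q u : u \in miso P Q -> u.1 @: P = Q.
Proof. by rewrite inE => /andP[/eqP]. Qed.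

Lemma miso_in P Q u n : u \in miso P Q -> n \in P -> u.1 n \in Q.
Proof. by move/miso_im => <- nP; apply: imset_f. Qed.

Lemma miso_fas P Q u : u \in miso P Q -> (restr P u.1, u.2) \in XX P Q.
Proof. by rewrite inE => /andP[]. Qed.

Lemma miso_Inj P Q u : u \in miso P Q -> restr P u.1 \in Inj P Q.
Proof. by move/miso_fas/fas_inj. Qed.

Lemma miso_morphic P Q u : u \in miso P Q -> morphic P u.1.
Proof. by move/miso_Inj/Inj_morphic. Qed.

Lemma misoE P Q u : (u \in miso P Q) = ((restr P u.1, u.2) \in misos_of XX P Q).
Proof.
rewrite inE; apply/andP/misos_ofP=> // [[/eqP bP bE]|[bE bP]].
  by split=> //; rewrite -bP; apply: eq_in_imset => y; apply: restr_in.
by split=> //; rewrite -bP eq_sym; apply/eqP/eq_in_imset=> y; apply: restr_in.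
Qed.

Lemma misos_of_miso P Q f s : (f, s) \in misos_of XX P Q ->
  exists2 b, (b, s) \in miso P Q & f = restr P b.
Proof.
move=> fI; have /misos_ofP[/fas_inj/=] := fI.
rewrite inE => /and4P[_ /dinjectiveP f_inj _ /eqP fr] _.
have [b bf] := perm_extension f_inj.
have fb : f = restr P b by rewrite fr; apply: eq_restr => y /bf.
by exists b; rewrite // misoE -fb.
Qed.

Lemma misoM P Q R u v : u \in miso P Q -> v \in miso Q R -> u * v \in miso P R.
Proof.
move=> uI vI; rewrite inE /=; apply/andP; split.
  rewrite -(miso_im vI) -(miso_im uI) -imset_comp; apply/eqP/eq_imset=> y.
  by rewrite /= permM.
rewrite -(hcomp_restr (Q := Q) (R := R)) ?(miso_Inj vI) ?(miso_im uI) //.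
exact: fas_comp (miso_fas uI) (miso_fas vI).
Qed.

Lemma misoV P Q u : u \in miso P Q -> u^-1 \in miso Q P.
Proof.
move=> uI; have uP := miso_im uI; have uVQ : u.1^-1 @: Q = P.
  rewrite -uP -imset_comp -[RHS]imset_id; apply: eq_imset => y.
  by rewrite /= permK.
rewrite inE /= uVQ eqxx /=; have := uI; rewrite misoE inE.
case/andP=> _ /exists_inP[[g t] gE /andP[/eqP[gu ut] _]].
suff -> : (restr Q u.1^-1, u.2^-1) = (g, t) by [].
congr (_, _); last by apply/eqP; rewrite eq_invg_mul ut.
have gr : g = restr Q g.
  by apply/eqP; have := fas_inj gE; rewrite inE => /and4P[].
rewrite gr; apply: eq_restr => z; rewrite -uP => /imsetP[y yP ->].
by have /ffunP/(_ y) := gu; rewrite !ffunE yP permK.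
Qed.

Lemma miso_sub P Q R u : R \subset P -> u \in miso P Q ->
  exists2 K : {group gT}, K \subset Q & u \in miso R K.
Proof.
move=> RP uI; have := fas_comp (fas_incl RP) (miso_fas uI).
have -> : mcomp (restr P u.1, u.2) (mid X R) = (restr R u.1, u.2).
  rewrite /mcomp /= mul1g; congr (_, _).
  apply/ffunP=> y; rewrite [LHS]ffunE [RHS]ffunE (ffunE _ y).
  case: ifP => [yR|_]; last exact: Inj1 (miso_Inj uI).
  by rewrite restr_in // (subsetP RP).
case/fas_fact=> K [KQ [[g t] gI ug]]; exists K => //.
by have /misos_ofP[/fas_inj gE _] := gI; rewrite misoE ug (mcomp1f gE).
Qed.

Lemma miso_widen P Q R u : Q \subset R -> u \in miso P Q ->
  (restr P u.1, u.2) \in XX P R.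
Proof.
move=> QR uI; have := fas_comp (miso_fas uI) (fas_incl QR).
by rewrite (@mcomp1f P) //; apply: (miso_Inj uI).
Qed.

Lemma miso1 P : 1 \in miso P P.
Proof.
rewrite inE /=; apply/andP; split.
  by apply/eqP; rewrite -[RHS]imset_id; apply: eq_imset => y; rewrite perm1.
have -> : restr P (1 : {perm gT}) = pid P by apply: eq_restr => y; rewrite perm1.
exact: fas_incl.
Qed.

Lemma miso_ell P Q u n : u \in miso P Q -> n \in P ->
  ell act n ^ u.2 = ell act (u.1 n).
Proof.
move/miso_fas/(subsetP (fas_sub _ _ _)); rewrite inE => /andP[_ /forall_inP uX] nP.
by rewrite (eqP (uX n nP)) /= restr_in.
Qed.

Lemma fiso_shadow (D : {group {perm X}}) (T : {group gT})
    (ellD : forall t, t \in T -> ell act t \in D)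
    P Q b :
  (b \in fiso (shadow_system XX ellD) P Q) = [exists s in D, (b, s) \in miso P Q].
Proof.
rewrite inE /= inE; apply/andP/exists_inP=> [[bP /exists_inP[s sD bs]]|[s sD]].
  by exists s; rewrite // inE bP.
by rewrite inE => /andP[bP bs]; split=> //; apply/exists_inP; exists s.
Qed.

Definition maut P : {set {perm gT} * {perm X}} := as_maut P (XX P P).

Lemma mautE P : maut P = [set u in miso P P | u.1 \in Aut P].
Proof.
apply/setP=> u; rewrite [in RHS]inE andbC [LHS]inE; apply: andb_id2l.
by rewrite {1}inE => /andP[/im_perm_on uP _]; rewrite inE uP eqxx.
Qed.

Fact maut_group_set P : group_set (maut P).
Proof.
rewrite mautE; apply/group_setP; split=> [|u v]; first by rewrite inE miso1 group1.
case/setIdP=> uI uA /setIdP[vI vA].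
by apply/setIdP; rewrite (misoM uI vI) /= groupM.
Qed.
Canonical maut_group P := Group (maut_group_set P).

(** This is the pair of c_m and l_m for the inverse m of n: with right
    conjugation and diagrammatic products this choice is a homomorphism. *)
Definition conj_pair P n : {perm gT} * {perm X} := (conj_aut P n, ell act n^-1).

Lemma conj_pairM P : {in 'N(P) &, {morph conj_pair P : m n / m * n}}.
Proof.
move=> m n mP nP; rewrite /conj_pair morphM // invMg ellM.
by [].
Qed.
Canonical conj_pair_morphism P := Morphism (@conj_pairM P).

End ActionIsomorphisms.

(** * Stabilizers in automorphism groups and extension of pairs *)

Section ActionStabilizers.

Variables (gT : finGroupType) (X : finType) (act : left_action gT X).
Variable XX : fusion_action_system act.
Implicit Types (P Q R H K : {group gT}) (x y : X).
Implicit Types (n : gT) (u v w : {perm gT} * {perm X}).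

Lemma conj_pairJ H K R Q u n : u \in miso XX H K -> R \subset H -> u.1 @: R = Q ->
  n \in H -> n \in 'N(R) -> conj_pair act R n ^ u = conj_pair act Q (u.1 n).
Proof.
move=> uI RH uR nH nR; rewrite /conj_pair.
transitivity (conj_aut R n ^ u.1, ell act n^-1 ^ u.2); first by [].
rewrite (conj_aut_morphic (miso_morphic uI) RH uR nH nR).
rewrite (miso_ell uI) ?groupV //; congr (_, ell act _).
by rewrite -!(morphmE (miso_morphic uI)) morphV.
Qed.

Lemma miso_norm H K R Q u n : u \in miso XX H K -> R \subset H -> u.1 @: R = Q ->
  n \in H -> n \in 'N(R) -> u.1 n \in 'N(Q).
Proof. by move=> uI RH uR; apply: morphic_norm (miso_morphic uI) RH uR. Qed.

Lemma mautJ P Q u : u \in miso XX P Q -> maut XX P :^ u = maut XX Q.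
Proof.
have sub R K v : v \in miso XX R K -> maut XX R :^ v \subset maut XX K.
  move=> vI; apply/subsetP=> _ /imsetP[a aA ->].
  move: aA; rewrite !mautE => /setIdP[aI aA]; apply/setIdP.
  rewrite /= (Aut_conj (miso_morphic vI) (miso_im vI) aA); split=> //.
  by rewrite conjgE (misoM (misoV vI)) // (misoM aI vI).
move=> uI; apply/eqP; rewrite eqEsubset sub //= -sub_conjgV sub //.
exact: misoV.
Qed.

Lemma as_maut_AutSX P : as_maut P (AutSX act P) = conj_pair act P @* 'N(P).
Proof.
apply/setP=> u; rewrite inE; apply/andP/idP=> [[uA /imsetP[n nN]]|].
  rewrite /mconj lconjE // => -[u1 u2].
  have -> : u = conj_pair act P n^-1.
    rewrite /conj_pair invgK -u2; case: u uA u1 {u2} => b s /= bA /Aut_restr_inj -> //.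
    exact: Aut_aut.
  by rewrite mem_morphim ?groupV.
case/morphimP=> n nN _ -> /=; split; first exact: Aut_aut.
apply/imsetP; exists n^-1; first by rewrite groupV.
by rewrite /mconj lconjE ?groupV // invgK.
Qed.

Lemma conj_pair_maut P : conj_pair act P @* 'N(P) \subset maut XX P.
Proof.
rewrite -as_maut_AutSX; apply/subsetP=> u; rewrite !inE => /andP[-> /=].
case/imsetP=> n nP ->; apply: fas_conj.
by rewrite !inE sub_conjgV (normP nP) subxx.
Qed.

Lemma ker_conj_pair P : 'ker (conj_pair act P) = 'C(P) :&: core act.
Proof.
apply/setP=> n; rewrite -ker_conj_aut in_setI [n \in core _]inE.
have [nP|nP] := boolP (n \in 'N(P)).
  rewrite !(sameP (kerP _ nP) eqP) /= /conj_pair ellV.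
  by rewrite -[LHS]/((conj_aut P n == 1) && ((ell act n)^-1 == 1)) invg_eq1.
have nK (rT : finGroupType) (f : {morphism 'N(P) >-> rT}) : n \in 'ker f = false.
  by apply: contraNF nP => /(subsetP (subsetIl _ _)).
by rewrite !nK.
Qed.

Lemma mem_mextender P Q u n : u \in miso XX P Q ->
  (n \in mextender act P Q (restr P u.1, u.2)) =
    (n \in 'N(P)) && (conj_pair act P n ^ u \in conj_pair act Q @* 'N(Q)).
Proof.
move=> uI; rewrite inE; apply: andb_id2l => nP.
rewrite /mcomp /= (Inj_conj_restr (miso_Inj uI) (miso_im uI) nP).
have cA : conj_aut P n^-1 ^ u.1 \in Aut Q.
  by rewrite (Aut_conj (miso_morphic uI) (miso_im uI)) // Aut_aut.
transitivity (conj_pair act P n^-1 ^ u \in as_maut Q (AutSX act Q)).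
  by rewrite inE /= cA /= invgK -mulgA.
by rewrite as_maut_AutSX morphV // conjVg groupV.
Qed.

Lemma miso_stab H K u y : u \in miso XX H K -> H \subset stab act y ->
  K \subset stab act (u.2 y).
Proof.
move=> uI Hy; apply/subsetP=> k; rewrite -(miso_im uI) => /imsetP[n nH ->].
have := subsetP Hy n nH; rewrite !inE => /eqP ny.
have -> z : act (u.1 n) z = ell act (u.1 n) z by rewrite permE.
by rewrite -(miso_ell uI nH) permJ permE ny.
Qed.

Definition maut_stab P y := [set u in maut XX P | u.2 y == y].

Fact maut_stab_group_set P y : group_set (maut_stab P y).
Proof.
apply/group_setP; split=> [|u v]; first by apply/setIdP; rewrite group1 /= perm1.
case/setIdP=> uA uy /setIdP[vA vy]; apply/setIdP.
by rewrite groupM //= permM (eqP uy).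
Qed.
Canonical maut_stab_group P y := Group (maut_stab_group_set P y).

Definition inner_stab P y := conj_pair act P @* 'N_(stab_group act y)(P).

Lemma conj_pair_stabE n y P : ((conj_pair act P n).2 y == y) = (n \in stab act y).
Proof.
rewrite /= permE; apply/eqP/idP=> [ny|].
  by rewrite -groupV inE ny.
by rewrite -groupV inE => /eqP.
Qed.

Lemma inner_stab_sub P y : inner_stab P y \subset maut_stab P y.
Proof.
apply/subsetP=> _ /morphimP[n nP /setIP[ny _] ->]; apply/setIdP.
by rewrite conj_pair_stabE ny (subsetP (conj_pair_maut P)) // mem_morphim.
Qed.

Lemma maut_stabJ P Q u y : u \in miso XX P Q -> maut_stab P y :^ u = maut_stab Q (u.2 y).
Proof.
move=> uI; apply/setP=> v; rewrite mem_conjg [LHS]inE [RHS]inE -mem_conjg (mautJ uI).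
have -> : (v ^ u^-1).2 y = u.2^-1 (v.2 (u.2 y)) by rewrite /= invgK !permM.
by rewrite -(inj_eq (@perm_inj _ u.2)) permKV.
Qed.

Variable p : nat.
Hypotheses (pS : p.-group [set: gT]) (satX : fas_saturated XX p).

Lemma inner_stab_pgroup P y : p.-group (inner_stab P y).
Proof. by rewrite morphim_pgroup // (pgroupS (subsetT _) pS). Qed.

(** The last hypothesis says that H lies in the extender of the pair. *)
Lemma miso_extend P Q H u : fully_X_centralized XX Q -> u \in miso XX P Q ->
    P \subset H -> H \subset 'N(P) ->
    conj_pair act P @* H :^ u \subset conj_pair act Q @* 'N(Q) ->
  exists v K, [/\ v \in miso XX H K, v.2 = u.2 & {in P, v.1 =1 u.1}].
Proof.
move=> cQ uI PH HP Hu; have := uI; rewrite misoE => uE.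
have [f fE fu] := fsat_ext satX cQ uE; set N := <<_>>%G in fE.
have HN : H \subset N.
  apply: subset_trans (subset_gen _); apply/subsetP=> n nH.
  have nP := subsetP HP n nH.
  by rewrite mem_mextender // nP (subsetP Hu) // memJ_conjg mem_morphim.
have [K [_ [[g t] gI [fg st]]]] := fas_fact fE.
have [/fas_inj gE _] := misos_ofP _ _ _ _ _ gI.
have [b bI gb] := misos_of_miso gI.
have [K' _ bI'] := miso_sub HN bI.
exists (b, u.2), K'; split=> //; first by rewrite st mulg1.
move=> y yP /=; have yN := subsetP (subset_trans PH HN) y yP.
have := restr_inj fu yP => <-; rewrite fg (hcomp1f gE) gb restr_in //.
Qed.

End ActionStabilizers.

(** * Receptive subgroups of a stabilizer *)

Section StabilizerSaturation.

Variables (gT : finGroupType) (X : finType) (act : left_action gT X).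
Variables (XX : fusion_action_system act) (p : nat).
Hypotheses (pS : p.-group [set: gT]) (satX : fas_saturated XX p).
Implicit Types (P Q R H K : {group gT}) (x y : X) (b : {perm gT}).
Implicit Types (n : gT) (u v w : {perm gT} * {perm X}).

Lemma under_conjugate P Q u : u \in miso XX P Q -> fconjugate (under XX) P Q.
Proof.
move=> uI; apply/fconjugateP; rewrite ?subsetT //; exists u.1.
rewrite fiso_shadow; apply/exists_inP; exists u.2; first by rewrite inE.
by rewrite -surjective_pairing.
Qed.

Lemma under_conjugateP P Q :
  reflect (exists u, u \in miso XX P Q) (fconjugate (under XX) P Q).
Proof.
apply: (iffP idP) => [/fconjugateP|[u /under_conjugate]//].
case=> [||b]; rewrite ?subsetT // fiso_shadow => /exists_inP[s _ bI].
by exists (b, s).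
Qed.

Lemma fully_normalized_conjugate P :
  exists2 Q, fully_normalized (under XX) Q & exists u, u \in miso XX P Q.
Proof.
have PP : fconjugate (under XX) P P by apply: under_conjugate (miso1 XX P).
case: (@arg_maxnP _ P (fconjugate (under XX) P) (fun Q => #|'N(Q)|) PP) => Q.
case/under_conjugateP=> u uI maxQ; exists Q; last by exists u.
move=> R _ /under_conjugateP[v vI]; rewrite !setTI; apply: maxQ.
exact: under_conjugate (misoM uI vI).
Qed.

(** A Sylow subgroup U of the stabilizer of y is conjugate in X(Q) into the Sylow
    subgroup Aut_S(Q;X); the conjugate of U fixes the image of y, hence lies in
    the part of Aut_S(Q;X) that comes from the stabilizer of this image. *)
Lemma inner_stab_Sylow Q y : fully_normalized (under XX) Q ->
  exists2 a, a \in maut XX Q &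
    p.-Sylow(maut_stab XX Q (a.2 y)) (inner_stab act Q (a.2 y)).
Proof.
move=> nQ; have [_ sylQ _] := fsat_sylow satX nQ.
rewrite as_maut_AutSX -/(maut XX Q) in sylQ.
have [U sylU] := Sylow_exists p (maut_stab_group XX Q y).
have sU : U \subset maut XX Q.
  by apply: subset_trans (pHall_sub sylU) _; apply/subsetP=> v /setIdP[].
have [a aA sUa] := Sylow_Jsub sylQ sU (pHall_pgroup sylU).
exists a => //; have aI : a \in miso XX Q Q by move: aA; rewrite /= mautE => /setIdP[].
have sylUa : p.-Sylow(maut_stab XX Q (a.2 y)) (U :^ a).
  by rewrite -(maut_stabJ y aI) pHallJ2.
have sUk : U :^ a \subset inner_stab act Q (a.2 y).
  apply/subsetP=> v vU; have /morphimP[n nQ' _ ve] := subsetP sUa v vU.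
  have /setIdP[_] := subsetP (pHall_sub sylUa) v vU.
  by rewrite ve conj_pair_stabE => ny; rewrite mem_morphim // inE ny.
have eqk : inner_stab act Q (a.2 y) = U :^ a.
  exact: sub_pHall sylUa (inner_stab_pgroup act pS Q (a.2 y)) sUk (inner_stab_sub _ _ _).
by rewrite eqk.
Qed.

Lemma fully_normalized1 : fully_normalized (under XX) 1.
Proof.
move=> R _ /under_conjugateP[u uI]; suff -> : R = 1%G by [].
by apply: val_inj; rewrite /= -(miso_im uI) imset_set1 -(morphmE (miso_morphic uI)) morph1.
Qed.

Lemma card_inner_stab1 y : #|inner_stab act 1 y| = #|stab act y| %/ #|core act|.
Proof.
have -> : #|inner_stab act 1 y| = #|stab act y : 'ker (conj_pair act 1)|.
  have e : 'N(1) :&: 'N_(stab_group act y)(1) = stab act y :> {set gT}.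
    by rewrite norm1 setIT setTI.
  by rewrite /inner_stab card_morphim e.
have -> : core act = 'ker (conj_pair act 1) by rewrite ker_conj_pair cent1T setTI.
rewrite -divgS //= ker_conj_pair; apply/subsetP=> n /setIP[_].
by rewrite !inE => /eqP/permP/(_ y); rewrite permE perm1 => /eqP.
Qed.

Lemma Sigma1P s : s \in Sigma XX 1 -> (1, s) \in miso XX 1 1.
Proof.
case/imsetP=> -[f t] fI /= ->; rewrite misoE; apply/misos_ofP; split; last first.
  rewrite imset_set1 restr_in ?set11 //.
  by rewrite perm1.
suff -> : restr 1 (1 : {perm gT}) = f by [].
have := fas_inj fI; rewrite /= => /[dup] fJ; rewrite inE => /and4P[_ _ _ /eqP ->].
by apply: eq_restr => y /set1P ->; rewrite perm1 (Inj1 fJ).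
Qed.

Variable x : X.
Hypotheses (trX : transitive_fas XX) (stx : fully_stabilized act x).

Lemma transitive_maut y : exists2 u, u \in maut XX 1 & u.2 y = x.
Proof.
have /imsetP[x0 _ Xx0] := trX.
have Sx0 z : exists2 s, s \in Sigma XX 1 & s x0 = z.
  by have : z \in [set: X]; rewrite // Xx0 => /imsetP[s sS ->]; exists s.
have [s /Sigma1P sI sy] := Sx0 y; have [t /Sigma1P tI tx] := Sx0 x.
exists ((1, s)^-1 * (1, t)); last first.
  by rewrite /= permM -sy permK.
rewrite mautE; apply/setIdP; split; first exact: misoM (misoV sI) tI.
by rewrite /= invg1 mulg1 group1.
Qed.

(** Some point in the orbit of x has this property by [inner_stab_Sylow], and the
    order |S_y : C| of the image of S_y in X(1) is largest at y = x. *)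
Lemma inner_stab1_Sylow : p.-Sylow(maut_stab XX 1 x) (inner_stab act 1 x).
Proof.
have [a aA syla] := inner_stab_Sylow x fully_normalized1.
have aI : a \in miso XX 1 1 by move: aA; rewrite mautE => /setIdP[].
have pK := inner_stab_pgroup act pS 1 x; rewrite pHallE inner_stab_sub.
rewrite eqn_leq /=; apply/andP; split.
  rewrite dvdn_leq ?part_gt0 // -(part_pnat_id pK).
  by rewrite partn_dvd ?cardG_gt0 // cardSg ?inner_stab_sub.
have <- : #|inner_stab act 1 (a.2 x)| = (#|maut_stab XX 1 x|`_p)%N.
  by rewrite (card_Hall syla) /= -(maut_stabJ x aI) cardJg.
by rewrite !card_inner_stab1 leq_div2r.
Qed.

(** An element of X(1) moving y to x conjugates the image of S_y into the
    stabilizer of x, and after correction by Sylow's theorem into the image of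
    S_x.  The extender of the resulting automorphism of 1 contains S_y. *)
Lemma stab_conjugate y : exists v R,
  [/\ v \in miso XX (stab_group act y) R, R \subset stab act x & v.2 y = x].
Proof.
have [u uA uy] := transitive_maut y.
have uI : u \in miso XX 1 1 by move: uA; rewrite mautE => /setIdP[].
have pK : p.-group (inner_stab act 1 y :^ u) by rewrite pgroupJ inner_stab_pgroup.
have sK : inner_stab act 1 y :^ u \subset maut_stab XX 1 x.
  by rewrite -uy -(maut_stabJ y uI) conjSg inner_stab_sub.
have [a /setIdP[aA /eqP ax] sKa] := Sylow_Jsub inner_stab1_Sylow sK pK.
have aI : a \in miso XX 1 1 by move: aA; rewrite mautE => /setIdP[].
have uaI := misoM uI aI.
have c1 : fully_X_centralized XX 1.
  have [cX _] := fsat_norm satX fully_normalized1; exact: fsat_Xnorm satX _ cX.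
have [||v [R [vI v2 _]]] := miso_extend satX c1 uaI (sub1G (stab_group act y)).
- by rewrite norm1 subsetT.
- rewrite conjsgM; apply: subset_trans (subset_trans _ sKa) _.
    by rewrite !conjSg morphimS // subsetI subxx /= norm1 subsetT.
  by rewrite morphimS // subsetIr.
have vy : v.2 y = x by rewrite v2 /= permM uy.
exists v, R; split=> //; rewrite -vy.
exact: miso_stab vI (subxx _).
Qed.

(** Receptivity for pairs fixing x: the permutation of X enters the hypothesis on
    H, and is kept by the extension. *)
Definition Xreceptive Q := forall R H u,
    u \in miso XX R Q -> u.2 x = x -> R \subset H ->
    H \subset 'N_(stab_group act x)(R) ->
    conj_pair act R @* H :^ u \subset inner_stab act Q x ->
  exists v K, [/\ v \in miso XX H K, v.2 = u.2 & {in R, v.1 =1 u.1}].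

(** Take a fully normalized conjugate Q of P in X, and use X(Q) to move the image
    y of x to a point where Aut_S(Q;X) meets X(Q)_y in a Sylow subgroup of
    X(Q)_y.  The embedding v of S_y in S_x carries Q to the required Q'.  It
    maps this Sylow subgroup into the subgroup induced by S_x on Q', hence onto
    it by maximality.  So an extension problem into Q' over S_x becomes, through
    the inverse of v, one into Q over S, which saturation solves; its solution
    has image in S_y, and v brings it back into S_x. *)
Lemma stab_receptive P : P \subset stab act x -> exists (Q : {group gT}) w,
  [/\ Q \subset stab act x, w \in miso XX P Q, w.2 x = x,
      p.-Sylow(maut_stab XX Q x) (inner_stab act Q x) & Xreceptive Q].
Proof.
move=> Px; have [Q nQ [u0 u0I]] := fully_normalized_conjugate P.
have [a aA syla] := inner_stab_Sylow (u0.2 x) nQ.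
have aI : a \in miso XX Q Q by move: aA; rewrite mautE => /setIdP[].
have uI := misoM u0I aI; set u := u0 * a in uI; set y := u.2 x.
have ay : a.2 (u0.2 x) = y by rewrite /y /u /= permM.
rewrite ay in syla.
have Qy : Q \subset stab act y := miso_stab uI Px.
have [v [S' [vI S'x vy]]] := stab_conjugate y.
have [Q' Q'S vQ] := miso_sub (P := stab_group act y) Qy vI.
have Q'x := subset_trans Q'S S'x.
have kv : inner_stab act Q y :^ v \subset inner_stab act Q' x.
  apply/subsetP=> _ /imsetP[_ /morphimP[n nQ' /setIP[ny _] ->] ->].
  rewrite (conj_pairJ vI Qy (miso_im vQ) ny nQ').
  have vnN := miso_norm vI Qy (miso_im vQ) ny nQ'.
  by rewrite mem_morphim // inE vnN andbT (subsetP S'x) // (miso_in vI).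
have sylv : p.-Sylow(maut_stab XX Q' x) (inner_stab act Q y :^ v).
  by rewrite -vy -(maut_stabJ y vQ) pHallJ2.
have eqk : inner_stab act Q' x = inner_stab act Q y :^ v.
  exact: sub_pHall sylv (inner_stab_pgroup act pS Q' x) kv (inner_stab_sub _ _ _).
exists Q', (u * v); split=> //; first exact: misoM uI vQ.
- by rewrite /= permM vy.
- by rewrite /= eqk.
move=> R H w wI wx RH HN Hk; have vV := misoV vQ.
have cQ : fully_X_centralized XX Q.
  have [cX _] := fsat_norm satX nQ; exact: fsat_Xnorm satX _ cX.
have [||e [K [eI e2 e1]]] := miso_extend satX cQ (misoM wI vV) RH.
- exact: subset_trans HN (subsetIr _ _).
- rewrite conjsgM; apply: subset_trans (_ : inner_stab act Q y \subset _).
    by rewrite sub_conjgV -eqk.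
  by rewrite morphimS // subsetIr.
have Ky : K \subset stab act y.
  have <- : e.2 x = y by rewrite e2 /= permM wx -vy permK.
  by apply: miso_stab eI _; apply: subset_trans HN (subsetIl _ _).
have [K' _ vK] := miso_sub (P := stab_group act y) Ky vI.
exists (e * v), K'; split; first exact: misoM eI vK.
  by rewrite /= e2 /= -mulgA mulVg mulg1.
by move=> z zR; rewrite /= permM e1 //= permM permKV.
Qed.

End StabilizerSaturation.

(** * The stabilizer fusion system *)

Section StabilizerFusionSystem.

Variables (gT : finGroupType) (X : finType) (act : left_action gT X).
Variables (XX : fusion_action_system act) (p : nat) (x : X).
Implicit Types (P Q R H K : {group gT}) (b : {perm gT}).
Implicit Types (n : gT) (u v w : {perm gT} * {perm X}).

Notation Sx := (stab_group act x).
Notation Fx := (stab_fusion XX x).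

Lemma mem_astab1 (s : {perm X}) : (s \in 'C[x | 'P]) = (s x == x).
Proof. by apply/astab1P/eqP; rewrite /= apermE. Qed.

Lemma stab_fisoP P Q b :
  reflect (exists2 s : {perm X}, s x = x & (b, s) \in miso XX P Q)
          (b \in fiso Fx P Q).
Proof.
rewrite fiso_shadow; apply: (iffP exists_inP) => -[s sx bs]; exists s => //.
  by apply/eqP; rewrite -mem_astab1.
by rewrite mem_astab1; apply/eqP.
Qed.

Lemma faut_stab Q : faut Fx Q = fst @* maut_stab XX Q x.
Proof.
apply/setP=> b; rewrite fautE morphimEsub ?subsetT //; apply/setIP/imsetP.
  case=> bA /stab_fisoP[s sx bs]; exists (b, s) => //.
  by apply/setIdP; rewrite /= sx mautE; split=> //; apply/setIdP.
case=> u /setIdP[]; rewrite mautE => /setIdP[uI uA] /eqP ux -> /=; split=> //.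
by apply/stab_fisoP; exists u.2; rewrite -?surjective_pairing.
Qed.

Lemma fst_conj_pair P H : H \subset 'N(P) -> fst @* (conj_pair act P @* H) = conj_aut P @* H.
Proof.
move=> HP; rewrite morphimEsub ?subsetT // !morphimEsub // -imset_comp.
exact: eq_imset.
Qed.

Hypotheses (pS : p.-group [set: gT]) (satX : fas_saturated XX p).

Lemma stab_automized Q : p.-Sylow(maut_stab XX Q x) (inner_stab act Q x) ->
  fully_automized Fx p Q.
Proof.
move=> sylQ; rewrite /fully_automized faut_stab -fst_conj_pair ?subsetIr //.
by apply: morphim_pHall; rewrite ?subsetT.
Qed.

(** An extension problem in F_x leaves the permutation of X free up to the
    kernel of the projection to F_x(Q); Sylow's theorem in the preimage of the
    inner automorphisms finds a choice for which the problem lifts to X. *)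
Lemma stab_fusion_receptive Q : p.-Sylow(maut_stab XX Q x) (inner_stab act Q x) ->
  Xreceptive XX x Q -> receptive Fx Q.
Proof.
move=> sylQ recQ R H b Rx /stab_fisoP[s sx uI] RH HN Hb.
set u := (b, s) in uI; have HR : H \subset 'N(R) := subset_trans HN (subsetIr _ _).
pose G := (maut_stab_group XX Q x :&: fst @*^-1 (conj_aut Q @* 'N_Sx(Q)))%G.
have sylG : p.-Sylow(G) (inner_stab act Q x).
  apply: pHall_subl sylQ; rewrite ?subsetIl // subsetI inner_stab_sub /=.
  by rewrite -sub_morphim_pre ?subsetT //= fst_conj_pair ?subsetIr.
have pV : p.-group (conj_pair act R @* H :^ u).
  by rewrite pgroupJ morphim_pgroup // (pgroupS (subsetT _) pS).
have sV : conj_pair act R @* H :^ u \subset G.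
  rewrite subsetI -sub_morphim_pre ?subsetT //; apply/andP; split.
    have e : maut_stab XX R x :^ u = maut_stab XX Q x by rewrite (maut_stabJ x uI) /= sx.
    by rewrite /= -e conjSg (subset_trans _ (inner_stab_sub XX R x)) // morphimS.
  by rewrite morphimJ ?inE //= fst_conj_pair.
(* g agrees with some conj_pair n on Q; their quotient k is trivial on Q, so it
   may be absorbed into the permutation s. *)
have [g /setIP[gM /morphpreP[_ gk]] sVg] := Sylow_Jsub sylG sV pV.
have [n nQ nN gn] := morphimP gk; set k := g * (conj_pair act Q n)^-1.
have k1 : k.1 = 1 by rewrite /= -gn mulgV.
have cM : conj_pair act Q n \in maut_stab XX Q x.
  by apply: (subsetP (inner_stab_sub XX Q x)); apply: mem_morphim.
have /setIdP[] : k \in maut_stab XX Q x by rewrite groupM ?groupV.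
rewrite mautE => /setIdP[kI _] /eqP kx.
have [||||v [K [vI v2 v1]]] := recQ R H (u * k) (misoM uI kI).
- by rewrite /= permM sx.
- by [].
- by [].
- rewrite conjsgM /k conjsgM sub_conjgV.
  have -> : inner_stab act Q x :^ conj_pair act Q n = inner_stab act Q x; last by [].
  by rewrite conjGid // mem_morphim.
have {v1} vb : {in R, v.1 =1 b}.
  have ukb : (u * k).1 = b by rewrite -[RHS]mulg1 -k1.
  by move=> y yR; rewrite v1 // ukb.
have vx : v.2 x = x by rewrite v2 /= permM sx.
exists v.1, K; split=> //.
  by rewrite -{1}vx (miso_stab vI) // (subset_trans HN) // subsetIl.
by apply/stab_fisoP; exists v.2; rewrite -?surjective_pairing.
Qed.

Hypotheses (trX : transitive_fas XX) (stx : fully_stabilized act x).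

Theorem stab_saturated : saturated p Fx.
Proof.
apply: receptive_saturated; first exact: pgroupS (subsetT _) pS.
move=> P Px; have [Q [w [Qx wI wx sylQ recQ]]] := stab_receptive pS satX trX stx Px.
exists Q, w.1; split=> //.
- by apply/stab_fisoP; exists w.2; rewrite -?surjective_pairing.
- exact: stab_automized.
exact: stab_fusion_receptive.
Qed.

End StabilizerFusionSystem.

(** * Centric subgroups and morphisms of the linking system *)

Section CentricSubgroups.

Variables (gT : finGroupType) (X : finType) (act : left_action gT X).
Variable XX : fusion_action_system act.
Implicit Types (P Q R H K : {group gT}) (x : X).
Implicit Types (n : gT) (u v w : {perm gT} * {perm X}).

Lemma miso_core P Q u n : u \in miso XX P Q -> n \in P ->
  (u.1 n \in core act) = (n \in core act).
Proof. by move=> uI nP; rewrite !inE -(miso_ell uI nP) conjg_eq1. Qed.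

Lemma XcentricP P :
  reflect (forall Q u, u \in miso XX P Q -> 'C(Q) :&: core act \subset Q)
          (P \in Xcentric XX).
Proof.
have ZC (Q : {group gT}) : ('Z(Q) :&: core act == 'C(Q) :&: core act) =
    ('C(Q) :&: core act \subset Q).
  rewrite eqEsubset setSI ?subsetIr //= /center -setIA subsetI subxx andbT.
  by [].
rewrite inE; apply: (iffP forallP) => [cP Q u uI|cP Q].
  by rewrite -ZC; apply: (implyP (cP Q)); apply: under_conjugate uI.
by apply/implyP=> /under_conjugateP[u uI]; rewrite ZC; apply: cP uI.
Qed.

Lemma Xcentric_sub P : P \in Xcentric XX -> 'C(P) :&: core act \subset P.
Proof. by move/XcentricP/(_ P 1 (miso1 XX P)). Qed.

Lemma Xcentric_miso P Q u :
  u \in miso XX P Q -> P \in Xcentric XX -> Q \in Xcentric XX.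
Proof.
move=> uI /XcentricP cP; apply/XcentricP=> R v vI.
exact: cP (misoM uI vI).
Qed.

Lemma Xcentric_over P Q : P \subset Q -> P \in Xcentric XX -> Q \in Xcentric XX.
Proof.
move=> PQ /XcentricP cP; apply/XcentricP=> R u uI.
have [K KR uK] := miso_sub PQ uI.
by rewrite (subset_trans _ (subset_trans (cP K u uK) KR)) // setSI // centS.
Qed.

(** For a conjugate Q of P, Z_S(Q;X) is contained in Q, so the isomorphism to P
    maps it injectively into Z_S(P;X). *)
Lemma Xcentric_centralized P : P \in Xcentric XX -> fully_X_centralized XX P.
Proof.
move=> cP Q _ /under_conjugateP[u uI].
have cQ := Xcentric_sub (Xcentric_miso uI cP).
have vI := misoV uI; have vQ := miso_im vI.
rewrite -(card_imset _ (@perm_inj _ u^-1.1)) subset_leq_card //.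
apply/subsetP=> _ /imsetP[n /[dup] nCc /(subsetP cQ) nQ ->].
have /setIP[nC nc] := nCc; rewrite inE (miso_core vI nQ) nc andbT.
apply/centP=> y; rewrite -vQ => /imsetP[z zQ ->].
have /morphicP vM := miso_morphic vI.
by rewrite /commute -!vM // (centP nC z zQ).
Qed.

Lemma core_stab x : core act \subset stab act x.
Proof.
by apply/subsetP=> n; rewrite !inE => /eqP/permP/(_ x); rewrite permE perm1 => /eqP.
Qed.

(** An isomorphism in X out of P maps C into C, hence onto C, so all conjugates
    of P contain C. *)
Lemma core_Xcentric P : core act \subset P -> P \in Xcentric XX.
Proof.
move=> cP; apply/XcentricP=> Q u uI; apply: subset_trans (subsetIr _ _) _.
have sub : u.1 @: core act \subset core act.
  by apply/subsetP=> _ /imsetP[n nc ->]; rewrite (miso_core uI) // (subsetP cP).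
have <- : u.1 @: core act = core act.
  by apply/eqP; rewrite eqEcard sub (card_imset _ (@perm_inj _ u.1)) leqnn.
by rewrite -(miso_im uI) imsetS.
Qed.

(** Both morphisms are an isomorphism onto f(P) followed by an inclusion, so one
    isomorphism can be composed with the inverse of the other. *)
Lemma fas_eq_hom P Q f (s t : {perm X}) : (f, s) \in XX P Q -> (f, t) \in XX P Q ->
  (pid P, s * t^-1) \in XX P P.
Proof.
have image (r : {perm X}) : (f, r) \in XX P Q ->
    exists2 R : {group gT}, R :=: f @: P & (f, r) \in misos_of XX P R.
  case/fas_fact=> R [_ [[g r'] gI]].
  have [/fas_inj gJ gP] := misos_ofP _ _ _ _ _ gI.
  by rewrite (mcomp1f gJ) => -[-> ->]; exists R; rewrite ?gP.
move=> /image[R Rf fsI] /image[R' R'f ftI].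
have eR : R = R' by apply: val_inj; rewrite /= Rf R'f.
have [a aI fa] := misos_of_miso fsI; have [b bI fb] := misos_of_miso ftI.
rewrite -eR in bI; have := miso_fas (misoM aI (misoV bI)).
suff -> : restr P ((a, s) * (b, t)^-1).1 = pid P by [].
apply: eq_restr => y yP; rewrite /= permM.
have -> : a y = b y by apply: (@restr_inj _ P a b); rewrite // -fa -fb.
by rewrite permK.
Qed.

End CentricSubgroups.

Section TransporterSystem.

Variables (gT : finGroupType) (X : finType) (act : left_action gT X).
Variables (XX : fusion_action_system act) (L : linking_action_system XX).

Notation cX := (ob [set: gT] (Xcentric XX)).
Notation trcX := (transporter_category [set: gT] (Xcentric XX)).

Definition lpair (P Q : cX) (g : hom L P Q) := val (lpi L P Q g).

Lemma lpair_fas (P Q : cX) (g : hom L P Q) : lpair g \in XX (obg P) (obg Q).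
Proof. exact: valP. Qed.

Lemma lpair1 (P : cX) : lpair (cid L P) = mid X (obg P).
Proof. by rewrite /lpair fmap1. Qed.

Lemma lpairM (P Q R : cX) (g : hom L P Q) (h : hom L Q R) :
  lpair (ccomp h g) = mcomp (lpair h) (lpair g).
Proof. by rewrite /lpair fmapM. Qed.

Lemma lpair_surj (P Q : cX) u : u \in XX (obg P) (obg Q) ->
  exists g : hom L P Q, lpair g = u.
Proof.
move=> uX; have [g gu] := las_surj L (exist _ u uX : hom (fas_category XX _ _) P Q).
by exists g; rewrite /lpair gu.
Qed.

Lemma lpair_orbit (P Q : cX) (g h : hom L P Q) : lpair g = lpair h ->
  exists2 z : hom trcX P P, val z \in 'Z(obg P) :&: core act
                          & h = ccomp g (ldelta L _ _ z).
Proof. by move=> gh; apply/las_orbit/val_inj. Qed.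

Lemma lpair_mid (P : cX) (e : hom L P P) : lpair e = mid X (obg P) ->
  exists2 z : hom trcX P P, val z \in 'Z(obg P) :&: core act & e = ldelta L _ _ z.
Proof.
rewrite -lpair1 => /esym/lpair_orbit[z zP ->]; exists z => //.
by rewrite ccomp1m.
Qed.

(** Axiom (B) gives this for elements of P, and for all elements of S when P is S;
    composing with the images of 1 in the morphisms to S gives the rest. *)
Lemma lpair_delta (P Q : cX) (t : hom trcX P Q) :
  lpair (ldelta L _ _ t) = mconj act (obg P) (val t).
Proof.
have l1 (R : cX) : lpair (ldelta L _ _ (to_top R 1)) = mid X (obg R).
  rewrite /lpair las_B ?group1 // /mconj /mid ell1; congr (_, _).
  by apply/ffunP=> y; rewrite !ffunE invg1 mulg1 mul1g.
have lS : lpair (ldelta L _ _ (to_top (topcX XX) (val t))) =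
          mconj act [set: gT] (val t).
  by rewrite /lpair las_B ?in_setT.
have /fas_inj tI := lpair_fas (ldelta L P Q t).
rewrite -(mcomp1f tI) -l1 -lpairM -fmapM.
transitivity (lpair (ldelta L _ _ (ccomp (to_top (topcX XX) (val t) : hom trcX _ _)
                                      (to_top P 1)))).
  by congr (lpair (ldelta L _ _ _)); apply: val_inj; rewrite /= mul1g mulg1.
rewrite fmapM lpairM lS l1 /mcomp /mconj /mid /= mul1g; congr (_, _).
apply/ffunP=> y; rewrite !ffunE in_setT; case: ifP => // _.
by rewrite mulg1 mulgV.
Qed.

Lemma ldelta1 (P : cX) (z : hom trcX P P) : val z = 1 ->
  ldelta L _ _ z = cid L P.
Proof. by move=> z1; rewrite -(fmap1 (ldelta L)); congr (ldelta L _ _ _); apply: val_inj. Qed.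

(** Cancelling the permutation of g shows that e lies over an identity morphism,
    so it comes from Z(P;X), which acts freely. *)
Lemma las_monic (P Q : cX) (g : hom L P Q) (e : hom L P P) :
  (lpair e).1 = pid (obg P) -> ccomp g e = g -> e = cid L P.
Proof.
move=> e1 ge; have : lpair e = mid X (obg P).
  rewrite [LHS]surjective_pairing e1; congr (_, _).
  have : (lpair (ccomp g e)).2 = (lpair g).2 by rewrite ge.
  by rewrite lpairM /= -[RHS]mul1g => /mulIg.
case/lpair_mid=> z zP ez; have gz : ccomp g (ldelta L _ _ z) = g by rewrite -ez.
by rewrite ez ldelta1 // (las_free zP gz).
Qed.

(** Here e comes from an element z of Z(Q;X).  As the image R of P is X-centric, z
    lies in R, and axiom (C) moves it across g to an element of Z(P;X), on the
    side where the action is free. *)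
Lemma las_epic (P Q : cX) (g : hom L P Q) (e : hom L Q Q) :
  (lpair e).1 = pid (obg Q) -> ccomp e g = g -> e = cid L Q.
Proof.
move=> e1 eg; have : lpair e = mid X (obg Q).
  rewrite [LHS]surjective_pairing e1; congr (_, _).
  have : (lpair (ccomp e g)).2 = (lpair g).2 by rewrite eg.
  by rewrite lpairM /= -[RHS]mulg1 => /mulgI.
case/lpair_mid=> z /setIP[zZ zc] ez; rewrite ez.
have /fas_fact[R [RQ [[f s] fI]]] := lpair_fas g.
have [/fas_inj fJ _] := misos_ofP _ _ _ _ _ fI; rewrite (mcomp1f fJ) => gf.
have [b bI fb] := misos_of_miso fI.
have cR := Xcentric_miso bI (ob_mem P).
have zR : val z \in R.
  apply: (subsetP (Xcentric_sub cR)); rewrite inE zc andbT.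
  by have /setIP[_] := zZ; apply: subsetP; apply: centS.
have bVI := misoV bI; pose a := b^-1 (val z).
have aP : a \in obg P by apply: (miso_in bVI zR).
have ba : b a = val z by rewrite permKV.
have aZ : a \in 'Z(obg P) :&: core act.
  rewrite !in_setI aP -(miso_core bI aP) /= ba zc andbT /=.
  apply/centP=> y yP; apply: (@perm_inj _ b).
  have /morphicP bM := miso_morphic bI.
  have /setIP[_ /centP zC] := zZ.
  rewrite !bM // ba; apply: zC; apply: (subsetP RQ).
  exact: (miso_in bI yP).
have at_P : a \in transp [set: gT] (obg P) (obg P).
  by rewrite inE in_setT conjGid ?groupV ?subxx.
pose ah : hom trcX P P := exist _ a at_P.
have ga : ccomp g (ldelta L _ _ ah) = g.
  rewrite -[RHS]eg ez; apply/esym/las_C => //=.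
    by rewrite -/(lpair g) gf fb restr_in // ba.
have a1 : a = 1 := las_free (z := ah) aZ ga.
by apply: ldelta1; rewrite -ba a1; have := Inj1 (miso_Inj bI); rewrite restr_in.
Qed.

End TransporterSystem.

(** * Extension of isomorphisms in the linking system *)

Section LinkingExtension.

Variables (gT : finGroupType) (X : finType) (act : left_action gT X).
Variables (XX : fusion_action_system act) (L : linking_action_system XX).
Variable p : nat.
Hypothesis satX : fas_saturated XX p.

Notation cX := (ob [set: gT] (Xcentric XX)).
Notation trcX := (transporter_category [set: gT] (Xcentric XX)).

Lemma lpair_inverse (P Q : cX) (g : hom L P Q) (h : hom L Q P) : inverse_pair g h ->
  exists2 b, (b, (lpair g).2) \in miso XX (obg P) (obg Q) & (lpair g).1 = restr (obg P) b.
Proof.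
case/andP=> /eqP hg /eqP gh; apply: misos_of_miso.
rewrite -surjective_pairing inE lpair_fas; apply/exists_inP; exists (lpair h).
  exact: lpair_fas.
by rewrite -!lpairM hg gh !lpair1 !eqxx.
Qed.

Lemma norm_hom (P : cX) n : n \in 'N(obg P) ->
  exists t : hom trcX P P, val t = n.
Proof.
move=> nP; have tP : n \in transp [set: gT] (obg P) (obg P).
  by rewrite inE in_setT /= sub_conjgV (normP nP).
by exists (exist _ n tP).
Qed.

(** An isomorphism g of L extends as soon as conjugation by g carries P' into
    Q': saturation extends the image of g in X, the image of the extension
    lies in Q' because Z_S(Q;X) does, and an element of Z(P;X) corrects the
    lift of the extension. *)
Lemma las_extend (P Q P' Q' : cX) (g : hom L P Q) (h : hom L Q P) :
    inverse_pair g h -> obg P <| obg P' -> obg Q <| obg Q' ->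
    (forall t : hom trcX P P, val t \in obg P' ->
       exists2 m : hom trcX Q Q, val m \in obg Q'
         & ccomp g (ccomp (ldelta L _ _ t) h) = ldelta L _ _ m) ->
  exists2 g' : hom L P' Q', lperm g' = lperm g &
    forall (i : hom trcX P P') (j : hom trcX Q Q'), val i = 1 -> val j = 1 ->
      ccomp g' (ldelta L _ _ i) = ccomp (ldelta L _ _ j) g.
Proof.
move=> gh /andP[PP' P'N] /andP[QQ' Q'N] gP'.
have [b uI gb] := lpair_inverse gh; set u := (b, _) in uI.
have bP y : y \in obg P -> b y \in obg Q by apply: (miso_in uI).
have kapQ' n : n \in obg P' ->
    exists2 m, m \in obg Q' & conj_pair act (obg P) n ^ u = conj_pair act (obg Q) m.
  move=> nP'; have nP := subsetP P'N n nP'.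
  have [t tn] := norm_hom (groupVr nP).
  have [|m mQ' tm] := gP' t; first by rewrite tn groupV.
  exists (val m)^-1; rewrite ?groupV //.
  have mN := subsetP Q'N _ mQ'.
  have : lpair (ccomp g (ldelta L _ _ t)) = lpair (ccomp (ldelta L _ _ m) g).
    rewrite -tm; case/andP: gh => /eqP hg _.
    by rewrite -!ccompA hg ccompm1.
  rewrite !lpairM !lpair_delta tn [lpair g]surjective_pairing gb /mcomp /mconj /=.
  case=> /ffunP e1 e2; congr (_, _); last first.
    change (ell act n^-1 ^ (lpair g).2 = ell act (val m)^-1^-1).
    by rewrite invgK conjgE e2 mulKg.
  have bA : conj_aut (obg P) n ^ b \in Aut (obg Q).
    by rewrite (Aut_conj (miso_morphic uI) (miso_im uI)) // Aut_aut.
  apply: (eq_Aut bA); first exact: Aut_aut.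
  move=> z zQ; have /imsetP[y yP ->] : z \in u.1 @: obg P by rewrite (miso_im uI).
  rewrite /= permJ.
  rewrite !norm_conj_autE ?groupV ?bP //.
  have := e1 y; rewrite !ffunE yP bP //.
  have -> : n^-1 * y * n^-1^-1 = y ^ n by rewrite invgK -mulgA -conjgE.
  by rewrite memJ_norm // yP => ->; rewrite [RHS]conjgE invgK mulgA.
(* Centricity of Q: two elements acting alike on Q and X differ by Z(Q;X). *)
have ckap n m : n \in 'N(obg Q) -> m \in 'N(obg Q) ->
    conj_pair act (obg Q) n = conj_pair act (obg Q) m -> n * m^-1 \in obg Q.
  move=> nN mN nm; apply: (subsetP (Xcentric_sub (ob_mem Q))).
  rewrite -ker_conj_pair; apply/kerP; first by rewrite groupM ?groupV.
  by rewrite morphM ?groupV // morphV //= nm mulgV.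
have [||v [K [vI v2 v1]]] := miso_extend satX (Xcentric_centralized (ob_mem Q)) uI PP'.
- exact: P'N.
- apply/subsetP=> _ /imsetP[_ /morphimP[n nN nP' ->] ->].
  have [m mQ' ->] := kapQ' n nP'.
  by apply: mem_morphim => //; apply: (subsetP Q'N).
have vPQ : v.1 @: obg P = obg Q by rewrite (eq_in_imset v1) (miso_im uI).
have KQ' : K \subset obg Q'.
  apply/subsetP=> y; rewrite -(miso_im vI) => /imsetP[n nP' ->].
  have nP := subsetP P'N n nP'; have [m mQ' km] := kapQ' n nP'.
  have vnN := miso_norm vI PP' vPQ nP' nP.
  rewrite -(mulgKV m (v.1 n)) groupM // (subsetP QQ') // ckap //.
    exact: (subsetP Q'N).
  rewrite -(conj_pairJ vI PP' vPQ nP' nP) -km /conj_pair.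
  change ((conj_aut (obg P) n ^ v.1, ell act n^-1 ^ v.2) =
          (conj_aut (obg P) n ^ b, ell act n^-1 ^ (lpair g).2)).
  by rewrite v2 (eq_conj_Aut (Aut_aut _ _) v1).
have [g0 g0v] := lpair_surj L (P := P') (Q := Q') (miso_widen KQ' vI).
have t1 (R R' : cX) : obg R \subset obg R' -> exists i : hom trcX R R', val i = 1.
  move=> RR'; have tR : 1 \in transp [set: gT] (obg R) (obg R').
    by rewrite inE in_setT invg1 conjsg1.
  by exists (exist _ 1 tR).
have [i0 i01] := t1 P P' PP'; have [j0 j01] := t1 Q Q' QQ'.
have mconj1 (R : {group gT}) : mconj act R 1 = mid X R.
  rewrite /mconj /mid ell1; congr (_, _).
  by apply/ffunP=> y; rewrite !ffunE invg1 mulg1 mul1g.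
have : lpair (ccomp g0 (ldelta L _ _ i0)) = lpair (ccomp (ldelta L _ _ j0) g).
  rewrite !lpairM !lpair_delta i01 j01 !mconj1 (mcomp1f (fas_inj (lpair_fas g))) g0v.
  rewrite [RHS]surjective_pairing gb /mcomp /= mul1g v2; congr (_, _).
  apply/ffunP=> y; rewrite [LHS]ffunE (ffunE _ y) [RHS]ffunE.
  case: ifP => yP; last exact: Inj1 (miso_Inj vI).
  by rewrite restr_in ?v1 // (subsetP PP').
case/lpair_orbit=> z /setIP[zZ zc] ez.
have zP' : val z \in obg P' by apply: (subsetP PP'); case/setIP: zZ.
have [z' z'z] := norm_hom (subsetP (normG (obg P')) _ zP').
exists (ccomp g0 (ldelta L _ _ z')).
  rewrite lpermM lperm_delta z'z /lperm -!/(lpair _) g0v /= v2.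
  by move: zc; rewrite inE => /eqP ->; rewrite mul1g.
move=> i j i1 j1; have -> : j = j0 by apply: val_inj; rewrite j1.
rewrite ez -!ccompA; congr (ccomp g0 _); rewrite -!fmapM.
by congr (ldelta L _ _ _); apply: val_inj; rewrite /= i1 i01 z'z mul1g mulg1.
Qed.

End LinkingExtension.

(** * The stabilizer transporter system *)

Section StabilizerTransporter.

Variables (gT : finGroupType) (X : finType) (act : left_action gT X).
Variables (XX : fusion_action_system act) (L : linking_action_system XX) (x : X).

Notation Sx := (stab_group act x).
Notation cX := (ob [set: gT] (Xcentric XX)).
Notation trcX := (transporter_category [set: gT] (Xcentric XX)).
Notation cXx := (ob (stab_group act x) (Xcentric XX)).
Notation trcXx := (transporter_category (stab_group act x) (Xcentric XX)).
Notation Lx := (stab_linking L x).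
Notation deltax := (stab_delta L x).

Section AutomorphismGroup.

Variable P : cXx.

(** The inverse makes this a homomorphism: composition is written from right to
    left in L, and products of permutations from left to right. *)
Definition aut_pair (a : autg Lx P) : {perm gT} * {perm X} :=
  let u := lpair (val (val a)) in (aut_of (obg P) u.1, u.2)^-1.

Lemma aut_lpair_Inj (a : autg Lx P) : (lpair (val (val a))).1 \in Inj (obg P) (obg P).
Proof. exact: fas_inj (lpair_fas (val (val a))). Qed.

Lemma aut_pairM : {in [set: autg Lx P] &, {morph aut_pair : a b / a * b}}.
Proof.
move=> a b _ _; rewrite /aut_pair -invMg; congr (_^-1).
have -> : lpair (val (val (a * b))) = mcomp (lpair (val (val a))) (lpair (val (val b))).
  exact: lpairM.
have [aA ra] := aut_ofP (aut_lpair_Inj a); have [bA rb] := aut_ofP (aut_lpair_Inj b).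
have abI : (mcomp (lpair (val (val a))) (lpair (val (val b)))).1 \in Inj (obg P) (obg P).
  by have := aut_lpair_Inj (a * b); rewrite -lpairM.
have [abA rab] := aut_ofP abI.
congr (_, _); apply: (Aut_restr_inj abA); first exact: groupM.
rewrite rab -(hcomp_restr (Q := obg P) (R := obg P)) ?ra ?rb ?aut_lpair_Inj //.
apply/subsetP=> _ /imsetP[y yP ->].
by rewrite (Aut_closed bA).
Qed.
Canonical aut_pair_morphism := Morphism aut_pairM.

Lemma aut_pair_stab a : aut_pair a \in maut_stab XX (obg P) x.
Proof.
rewrite /aut_pair groupV; have [aA ra] := aut_ofP (aut_lpair_Inj a).
apply/setIdP; split; last exact: valP (val a).
by rewrite inE /= aA ra -surjective_pairing; exact: lpair_fas.
Qed.

Lemma stab_tr_norm (t : hom trcXx P P) : val t \in 'N_Sx(obg P).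
Proof.
have := valP t; rewrite inE => /andP[tS tP]; apply/setIP; split=> //.
by rewrite -groupV inE.
Qed.

Lemma stab_tr n : n \in 'N_Sx(obg P) -> exists t : hom trcXx P P, val t = n.
Proof.
case/setIP=> nS nN; have nP : n \in transp Sx (obg P) (obg P).
  by rewrite inE nS /= sub_conjgV (normP nN).
by exists (exist _ n nP).
Qed.

Lemma aut_pair_delta a (t : hom trcXx P P) : val a = deltax _ _ t ->
  aut_pair a = conj_pair act (obg P) (val t).
Proof.
move=> at_; have /setIP[_ tN] := stab_tr_norm t.
rewrite /aut_pair at_ /= lpair_delta /=.
have lI : lconj (obg P) (val t) \in Inj (obg P) (obg P).
  by have := aut_lpair_Inj a; rewrite at_ /= lpair_delta.
have [aA ra] := aut_ofP lI; apply: (canLR invgK); rewrite -morphV //= /conj_pair invgK.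
congr (_, _); apply: (Aut_restr_inj aA); first exact: Aut_aut.
by rewrite ra lconjE.
Qed.

Lemma delta_aut (t : hom trcXx P P) : exists a : autg Lx P, val a = deltax _ _ t.
Proof.
have [|s st] := @stab_tr (val t)^-1; first by rewrite groupV stab_tr_norm.
have inv : inverse_pair (deltax _ _ t) (deltax _ _ s).
  rewrite /inverse_pair -!fmapM -!(fmap1 deltax).
  by apply/andP; split; apply/eqP; congr (deltax _ _ _); apply: val_inj;
    rewrite /= st ?mulVg ?mulgV.
have tU : [exists s', inverse_pair (deltax _ _ t) s'] by apply/existsP; exists (deltax _ _ s).
by exists (exist _ (deltax _ _ t) tU).
Qed.

Lemma ker_aut_pair (a : autg Lx P) : aut_pair a = 1 ->
  exists t : hom trcXx P P, val a = deltax _ _ t.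
Proof.
move=> a1; have [aA ra] := aut_ofP (aut_lpair_Inj a).
have : lpair (val (val a)) = mid X (obg P).
  have e : (aut_of (obg P) (lpair (val (val a))).1, (lpair (val (val a))).2) = 1.
    by apply: invg_inj; rewrite invg1.
  rewrite [LHS]surjective_pairing -ra; congr (_, _); last by case: e.
  case: e => -> _; apply: eq_restr => y _; exact: perm1.
case/lpair_mid=> z /setIP[/setIP[zP _] _] az.
have zt : val z \in transp Sx (obg P) (obg P).
  by rewrite inE (subsetP (ob_sub P)) //= conjGid ?groupV ?subxx.
exists (exist _ (val z) zt); apply: val_inj; rewrite /= az.
by congr (ldelta L _ _ _); apply: val_inj.
Qed.

Definition delta_auts : {set autg Lx P} :=
  [set a | val a \in delta_im deltax P Sx].

Lemma delta_autsP a :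
  reflect (exists t, val a = deltax _ _ t) (a \in delta_auts).
Proof.
rewrite inE; apply: (iffP imsetP) => [[t _ ->]|[t ->]]; first by exists t.
exists t => //; rewrite inE.
by case/setIP: (stab_tr_norm t).
Qed.

(** The kernel of [aut_pair] is Z(P;X), contained in P, so the image of delta is a
    full preimage. *)
Lemma delta_autsE : delta_auts = aut_pair @*^-1 inner_stab act (obg P) x.
Proof.
apply/setP=> a; apply/delta_autsP/morphpreP=> [[t at_]|[_]].
  split; rewrite ?inE //= (aut_pair_delta at_).
  by rewrite mem_morphim ?stab_tr_norm //; case/setIP: (stab_tr_norm t).
case/morphimP=> n nN nS an; have [t tn] := stab_tr nS.
have [b bt] := delta_aut t.
have [s bs] : exists s, val (b^-1 * a) = deltax P P s.
  apply: ker_aut_pair; rewrite aut_pairM ?inE // (morphV aut_pair_morphism) ?inE //=.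
  by rewrite (aut_pair_delta bt) an tn mulVg.
exists (ccomp (t : hom trcXx P P) s); rewrite fmapM -bt -bs.
transitivity (val (b * (b^-1 * a))); last by [].
by rewrite mulKVg.
Qed.

Lemma stab_delta_inj (Q R : cXx) : injective (deltax Q R).
Proof.
move=> s t /(congr1 val)/= /las_inj/(congr1 val)/= st.
exact: val_inj.
Qed.

Lemma card_delta_auts : #|delta_auts| = #|'N_Sx(obg P)|.
Proof.
have vI : injective (fun a : autg Lx P => val a) by exact: val_inj.
rewrite -(card_imset _ vI).
have <- : deltax P P @: [set: hom trcXx P P] =
          (fun a : autg Lx P => val a) @: delta_auts.
  apply/setP=> g; apply/imsetP/imsetP=> [[t _ ->]|[a /delta_autsP[t at_] ->]].
    by have [a at_] := delta_aut t; exists a; rewrite //; apply/delta_autsP; exists t.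
  by exists t; rewrite ?inE.
rewrite card_imset; last exact: stab_delta_inj.
rewrite cardsT card_sig; apply: eq_card => n.
transitivity (n \in transp Sx (obg P) (obg P)); first by [].
rewrite in_setI inE; congr (_ && _).
by rewrite -[RHS]groupV inE.
Qed.

Lemma delta_auts_Sylow (p : nat) : p.-group [set: gT] ->
  p.-Sylow(maut_stab XX (obg P) x) (inner_stab act (obg P) x) ->
  p.-Sylow([set: autg Lx P]) delta_auts.
Proof.
move=> pS sylP; rewrite /pHall subsetT /=; apply/andP; split.
  by rewrite /pgroup card_delta_auts; apply: (pgroupS (subsetT _) pS).
pose G := (aut_pair_morphism @* [set: autg Lx P])%G.
have Gm : G \subset maut_stab XX (obg P) x.
  by apply/subsetP=> _ /morphimP[a _ _ ->]; apply: aut_pair_stab.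
have kG : inner_stab act (obg P) x \subset G.
  apply/subsetP=> _ /morphimP[n nN nS ->]; have [t tn] := stab_tr nS.
  have [b bt] := delta_aut t; rewrite /= -tn -(aut_pair_delta bt).
  by apply: mem_morphim; rewrite inE.
rewrite delta_autsE.
have eG : aut_pair @*^-1 G = [set: autg Lx P].
  by apply/setP=> a; rewrite [RHS]inE; apply/morphpreP; rewrite inE mem_morphim ?inE.
have := index_morphpre (f := aut_pair_morphism) (inner_stab act (obg P) x) (subxx G).
rewrite eG => ->.
by have /and3P[] := pHall_subl kG Gm sylP.
Qed.

End AutomorphismGroup.
Variable p : nat.
Hypotheses (pS : p.-group [set: gT]) (satX : fas_saturated XX p).
Hypotheses (trX : transitive_fas XX) (stx : fully_stabilized act x).

(** S_x is alone in its class in F_x. *)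
Lemma top_inner_stab_Sylow : p.-Sylow(maut_stab XX Sx x) (inner_stab act Sx x).
Proof.
have [Q [w [Qx wI _ sylQ _]]] := stab_receptive pS satX trX stx (subxx (stab act x)).
suff <- : Q = stab_group act x by [].
apply/val_inj/eqP; rewrite eqEcard Qx /= -(miso_im wI).
by rewrite (card_imset _ (@perm_inj _ w.1)).
Qed.

Lemma stab_transporter : transporter_system p (stab_delta L x) (stab_pi L x).
Proof.
have kerP (P : cXx) (e : hom Lx P P) : e \in ker_pi (stab_pi L x) P ->
    (lpair (val e)).1 = pid (obg P) by rewrite inE => /eqP.
split.
- move=> P Q Qx /fconjugateP-/(_ (ob_sub P) Qx)[b /stab_fisoP[s _ bI]].
  exact: Xcentric_miso bI (ob_mem P).
- by move=> P Q _ PQ; apply: Xcentric_over PQ (ob_mem P).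
- move=> P Q g e /kerP e1 ge; apply: val_inj.
  exact: (las_monic e1 (congr1 val ge)).
- move=> P Q g e /kerP e1 eg; apply: val_inj.
  exact: (las_epic e1 (congr1 val eg)).
- move=> P Q [f fE]; have := fE; rewrite inE => /exists_inP[s sx fsX].
  have [g gfs] := lpair_surj L (P := up P) (Q := up Q) fsX.
  have gx : lperm g x == x by rewrite /lperm -/(lpair g) gfs -mem_astab1.
  by exists (exist _ g gx); apply: val_inj; rewrite /= -/(lpair g) gfs.
- move=> P Q g h; split=> [gh|[e /kerP e1 ->]].
    have ghc : (lpair (val g)).1 = (lpair (val h)).1 by case: gh.
    have gX := lpair_fas (val g); have hX := lpair_fas (val h).
    rewrite [lpair _]surjective_pairing in gX.
    rewrite [lpair _]surjective_pairing -ghc in hX.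
    have [e0 e0v] := lpair_surj L (P := up P) (Q := up P) (fas_eq_hom hX gX).
    have : lpair (ccomp (val g) e0) = lpair (val h).
      rewrite lpairM e0v /mcomp /= mulgKV [RHS]surjective_pairing -ghc.
      by rewrite (hcompf1 (fas_inj gX)).
    (* As h is the composite of g with e, and both g and h fix x, so does e. *)
    case/lpair_orbit=> z zP ez; pose e := ccomp e0 (ldelta L _ _ z).
    have ex : lperm e x == x.
      rewrite -(inj_eq (@perm_inj _ (lperm (val g)))) -permM -lpermM /e ccompA -ez.
      by rewrite (eqP (valP h : lperm (val h) x == x)) eq_sym (valP g).
    exists (exist _ e ex); last by apply: val_inj; rewrite /= ez ccompA.
    rewrite inE /= -/(lpair e) lpairM e0v lpair_delta; apply/eqP/ffunP=> y /=.
    have /setIP[/setIP[_ /centP zC] _] := zP.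
    rewrite !ffunE; case: (boolP (y \in _)) => [yP|_]; last by rewrite if_same.
    by rewrite zC // mulgK yP.
  apply: val_inj; rewrite /= -!/(lpair _) lpairM /= e1.
  by rewrite (hcompf1 (fas_inj (lpair_fas (val g)))).
- exact: stab_delta_inj.
- by move=> P Q t; rewrite /= -/(lpair _) lpair_delta.
- move=> P Q g u v uP vu; apply: val_inj => /=.
  exact: las_C.
- have SxX : Sx \in Xcentric XX := core_Xcentric XX (core_stab act x).
  exists (exist _ Sx (introT andP (conj SxX (subxx _)))) => //.
  apply: delta_auts_Sylow => //.
  exact: top_inner_stab_Sylow.
move=> P Q P' Q' g h /andP[/eqP hg /eqP gh] PP' QQ' gP'.
have [|||t tP'|g' g'g g'v] := @las_extend _ _ _ _ L p satX (up P) (up Q) (up P')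
                                (up Q') (val g) (val h).
- by rewrite /inverse_pair -[ccomp _ _]/(val (ccomp h g)) hg
     -[ccomp (val g) _]/(val (ccomp g h)) gh /= !eqxx.
- exact: PP'.
- exact: QQ'.
- have tN : val t \in 'N_Sx(obg P).
    rewrite inE (subsetP (ob_sub P') _ tP').
    by have /andP[_ /subsetP->] := PP'.
  have [s st] := stab_tr tN.
  have [|m mQ' ghm] := imsetP (gP' (deltax _ _ s) _).
    by apply: imset_f; rewrite inE st.
  exists (up_tr m); first by move: mQ'; rewrite inE.
  have := congr1 val ghm; rewrite /= => <-.
  by congr (ccomp _ (ccomp (ldelta L _ _ _) _)); apply: val_inj; rewrite /= st.
have gx : lperm g' x == x by rewrite g'g (valP g).
exists (exist _ g' gx) => i j i1 j1; apply: val_inj => /=.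
exact: g'v.
Qed.

End StabilizerTransporter.

Theorem proposition3p5p7 (p : nat) (gT : finGroupType) (X : finType)
    (act : left_action gT X) (XX : fusion_action_system act)
    (L : linking_action_system XX) (x : X) :
  prime p -> p.-group [set: gT] ->
  transitive_fas XX -> fas_saturated XX p -> fully_stabilized act x ->
  [/\ forall P Q : {group gT}, stab_fusion XX x P Q \subset under XX P Q,
      saturated p (stab_fusion XX x)
    & transporter_system p (stab_delta L x) (stab_pi L x)].
Proof.
move=> _ pS trX satX stx; split.
- move=> P Q; apply/subsetP=> f; rewrite !inE => /exists_inP[s _ fs].
  by apply/exists_inP; exists s; rewrite ?inE.
- exact: stab_saturated.
exact: stab_transporter.
Qed.
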